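(* Let $\mu,\nu$ be probability measures on $\mathcal{X}$ with $\mu\ll\nu$. Assume there is a finite $n_0$ with $E^\mu[D(\pi_{n_0}^\mu\|\pi_{n_0}^\nu)]<\infty$ and some $m$ with $D(P^\mu|_{\mathcal{F}^{\mathcal{Y}}_{0,m}}\|P^\nu|_{\mathcal{F}^{\mathcal{Y}}_{0,m}})<\infty$. Then $\lim_{n\to\infty}E^\mu[D(\pi_n^\mu\|\pi_n^\nu)]=0$ if and only if $\lim_{n\to\infty}E^\mu[\|\pi_n^\mu-\pi_n^\nu\|_{TV}]=0$.
   Context: Setting: $\mathcal{X},\mathcal{Y},\mathcal{Z}$ are Polish spaces. $T$ is a transition kernel on $\mathcal{X}$; $\{Z_n\}$ is i.i.d. with law $Q$, independent of the states; $h:\mathcal{X}\times\mathcal{Z}\to\mathcal{Y}$ measurable. $\{X_n\}$ is a Markov chain with kernel $T$, $X_0\sim\mu$, $Y_n=h(X_n,Z_n)$; $P^\mu$, $E^\mu$ are the joint law on $(\mathcal{X}\times\mathcal{Y})^{\mathbb{Z}_+}$ and expectation. Filter $\pi_n^{\mu}=P^{\mu}(X_n\in\cdot\mid Y_0,\dots,Y_n)$. $\mathcal{F}^{\mathcal{Y}}_{0,m}$ is the $\sigma$-field generated by $Y_0,\dots,Y_m$, and $P|_{\mathcal{G}}$ denotes restriction to $\mathcal{G}$. Relative entropy $D(P\|R)=\int\log\frac{dP}{dR}\,dP$ for $P\ll R$. Total variation: $\|P-R\|_{TV}=\sup_{\|f\|_\infty\le1}|\int f\,dP-\int f\,dR|$.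 *)

(* Defs.v *)
From HB Require Import structures.
From mathcomp Require Import all_boot all_order all_algebra.
From mathcomp Require Import all_classical all_reals all_analysis.
From mathcomp Require Import measurable_realfun.
Import Order.TTheory GRing.Theory Num.Theory.
Import numFieldNormedType.Exports.

Set Implicit Arguments.
Unset Strict Implicit.
Unset Printing Implicit Defensive.

Local Open Scope classical_set_scope.
Local Open Scope ring_scope.

Section defs.
Context (R : realType).

(* X is a standard Borel space: Borel-isomorphic to a Borel subset of R.
   This is exactly the measurable structure of a Polish space (Kuratowski). *)
Definition standard_borel {d} (X : measurableType d) : Prop :=
  exists f : X -> R,
    [/\ measurable_fun setT f, injective f, measurable (range f)
      & forall A, measurable A -> measurable (f @` A)].

Definition measurable_wrt {O : Type} {d} {S : measurableType d}
  (G : set (set O)) (f : O -> S) : Prop :=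
  forall B : set S, measurable B -> G (f @^-1` B).

Definition sigma_upto {dO dS} {O : measurableType dO} {S : measurableType dS}
  (F : nat -> O -> S) (n : nat) : set (set O) :=
  <<s setT, \bigcup_(i in `I_n.+1) preimage_set_system setT (F i) measurable >>.

Definition density_on {d} {S : measurableType d} (G : set (set S))
  (P Q : {measure set S -> \bar R}) (f : S -> R) : Prop :=
  [/\ measurable_wrt G f, (forall x, 0 <= f x)
    & forall A, G A -> P A = (\int[Q]_(x in A) (f x)%:E)%E].

(* relative entropy D(P|_G || Q|_G) = \int log (dP/dQ on G) dP,
   and +oo when P|_G is not absolutely continuous w.r.t. Q|_G *)
Definition rel_entropy_on {d} {S : measurableType d} (G : set (set S))
  (P Q : {measure set S -> \bar R}) : \bar R :=
  match pselect (exists f, density_on G P Q f) with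
  | left H => (\int[P]_x (ln (projT1 (cid H) x))%:E)%E
  | right _ => +oo%E
  end.

Definition rel_entropy {d} {S : measurableType d}
  (P Q : {measure set S -> \bar R}) : \bar R :=
  rel_entropy_on measurable P Q.

Definition tv_dist {d} {S : measurableType d}
  (P Q : {measure set S -> \bar R}) : \bar R :=
  ereal_sup [set `| (\int[P]_x (f x)%:E - \int[Q]_x (f x)%:E)%E |%E
            | f in [set f : S -> R | measurable_fun setT f /\
                                     forall x, `|f x| <= 1]].

Definition obs {dO dX dY dZ} {O : measurableType dO} {X : measurableType dX}
  {Y : measurableType dY} {Z : measurableType dZ}
  (h : X -> Z -> Y) (Xs : nat -> O -> X) (Zs : nat -> O -> Z) : nat -> O -> Y :=
  fun n w => h (Xs n w) (Zs n w).

(* Under P, (X_n) is a Markov chain with kernel T (w.r.t. its natural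
   filtration) and X_0 ~ init; (Z_n) is i.i.d. with law Q and independent
   of the whole state process (X_n). *)
Definition hmm_law {dO dX dZ} {O : measurableType dO} {X : measurableType dX}
  {Z : measurableType dZ} (T : R.-pker X ~> X) (Q : probability Z R)
  (Xs : nat -> O -> X) (Zs : nat -> O -> Z)
  (P : probability O R) (init : probability X R) : Prop :=
  [/\ forall A, measurable A -> P (Xs 0 @^-1` A) = init A,
      forall n G B, sigma_upto Xs n G -> measurable B ->
        P (G `&` Xs n.+1 @^-1` B) = (\int[P]_(w in G) T (Xs n w) B)%E
    & forall N G (B : nat -> set Z), sigma_upto Xs N G ->
        (forall i, measurable (B i)) ->
        P (G `&` \bigcap_(i in `I_N.+1) (Zs i @^-1` B i)) =
        (P G * \prod_(i < N.+1) Q (B i))%E].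

Definition is_filter {dO dX dY} {O : measurableType dO} {X : measurableType dX}
  {Y : measurableType dY} (P : probability O R)
  (Xs : nat -> O -> X) (Ys : nat -> O -> Y) (n : nat)
  (pi : O -> probability X R) : Prop :=
  forall A, measurable A ->
    measurable_wrt (S := \bar R) (sigma_upto Ys n) (fun w => pi w A) /\
    forall B, sigma_upto Ys n B ->
      P (B `&` Xs n @^-1` A) = (\int[P]_(w in B) pi w A)%E.

End defs.

(* Main.v *)
(** Let [P], [Q] be the laws started from [mu], [nu].  By the Markov property
    [P] has density [M_n] with respect to [Q] on the field [G_n] generated by
    [Y_0, ..., Y_n] and [X_n], and the same [M_k] is still the density on the
    field obtained by adding the states and noises after time [k].  If [L_n] is
    the density on the field of [Y_0, ..., Y_n], the two filters at time [n]
    have likelihood ratio [r_n = M_n / L_n], so that, with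
    [phi r = r ln r - r + 1], the expected entropy [D_n] is the mean of [phi r_n]
    and the expected total variation [V_n] the mean of [|r_n - 1|] under the
    second filter.

    Entropy controls total variation since
    [|r - 1| <= e (r + 1) + phi r / (2 e)].  Conversely
    [D_n <= K V_n + E_P [ln r_n ; r_n > K]], and with [K = exp (4 c)] the last
    term is at most twice the sum of [E_P (ln (M_n / L_n0) - c)^+] and
    [E_P (ln (L_n0 / L_n) - c)^+].  The second is at most [exp (- c)] because
    [E_P (L_n0 / L_n) <= 1]; the first is at most its value at [n = n0], by the
    inequality [ln x <= x - 1] applied to [M_n / M_n0], whose [P]-mean on a
    [G_n]-event [A] is at most [P A].  Finiteness of [D_n0] makes that value small
    for large [c], uniformly in [n >= n0]. *)
Require Import Defs.
From HB Require Import structures.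
From mathcomp Require Import all_boot all_order all_algebra.
From mathcomp Require Import all_classical all_reals all_analysis.
From mathcomp Require Import measurable_realfun.
From mathcomp Require Import finmap ring lra.
Import Order.TTheory GRing.Theory Num.Theory.
Import numFieldNormedType.Exports.

Set Implicit Arguments.
Unset Strict Implicit.
Unset Printing Implicit Defensive.

Local Open Scope classical_set_scope.
Local Open Scope ring_scope.
Local Open Scope ereal_scope.
Import HBNNSimple.

(** * Positive functionals *)

(** By the chain rule [D_n] is the entropy of the pair formed by the observations and the current
    state, minus the entropy of the observations. Either term may be infinite at a given [n], so the
    argument does not follow this difference as [n] grows. Instead every [M_n] is compared with the
    one reference [L_n0]. The field of time [n0], enlarged by the later states and noises, contains
    [G_n], so going from [M_n0] to [M_n] restricts both laws to a smaller field, and such a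
    restriction cannot increase the tail of a log-likelihood ratio. Enlarging the field leaves
    [M_n0] unchanged because both laws share the transition kernel and the noise law. Cutting
    logarithms off at a level [c] keeps the tail estimates within integrals of nonnegative
    functions.

    Conditional expectations never appear as objects. Bayes' formula, the Markov property and
    disintegration are identities between integrals, obtained by recognising both sides as measures
    and comparing them on a family closed under intersection. *)

Definition positive_functional {d} {S : measurableType d} {R : realType}
    (K : (S -> \bar R) -> \bar R) : Prop :=
  [/\ forall f, (forall x, 0 <= f x) -> 0 <= K f,
      forall (c : R) f, (0 <= c)%R -> measurable_fun setT f ->
        (forall x, 0 <= f x) -> K (fun x => c%:E * f x) = c%:E * K f,
      forall f g, measurable_fun setT f -> (forall x, 0 <= f x) ->
        measurable_fun setT g -> (forall x, 0 <= g x) ->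
        K (fun x => f x + g x) = K f + K g
    & forall f : (S -> \bar R)^nat, (forall n, measurable_fun setT (f n)) ->
        (forall n x, 0 <= f n x) -> (forall x, nondecreasing_seq (f ^~ x)) ->
        K (f n) @[n --> \oo] --> K (fun x => limn (f ^~ x))].


Section functional_measure.
Context {d} {S : measurableType d} {R : realType} (K : (S -> \bar R) -> \bar R).
Hypothesis KP : positive_functional K.

Let K0 : K (cst 0) = 0.
Proof.
case: KP => _ KZ _ _.
have := KZ 0%R (cst 0) (lexx _) (@measurable_cst _ _ _ _ setT 0) (fun=> lexx _).
rewrite mul0e => KE; rewrite -[RHS]KE; congr K; apply/funext => x.
by rewrite mul0e.
Qed.

Let K_sum (I : Type) (s : seq I) (f : I -> S -> \bar R) :
  (forall i, measurable_fun setT (f i)) -> (forall i x, 0 <= f i x) ->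
  K (fun x => \sum_(i <- s) f i x) = \sum_(i <- s) K (f i).
Proof.
case: KP => _ _ KD _ mf f0; elim: s => [|i s ih].
  rewrite big_nil -[RHS]K0; congr K; apply/funext => x; by rewrite big_nil.
rewrite big_cons -ih -KD//.
- congr K; apply/funext => x; by rewrite big_cons.
- exact: emeasurable_sum.
- by move=> x; apply: sume_ge0 => j _.
Qed.

Definition functional_measure (A : set S) := K (fun x => (\1_A x)%:E).

Let mu0 : functional_measure set0 = 0.
Proof. by rewrite -[RHS]K0; congr K; apply/funext => x; rewrite indic0. Qed.

Let mu_ge0 A : 0 <= functional_measure A.
Proof. by case: KP => + _ _ _; apply => x; rewrite lee_fin. Qed.

Let mu_sigma : semi_sigma_additive functional_measure.
Proof.
move=> F mF tF mUF; case: KP => _ _ _ Klim.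
rewrite (_ : (fun n => _) =
  fun n => K (fun x => \sum_(i <- index_iota 0 n) (\1_(F i) x)%:E)); last first.
  apply/funext => n; rewrite (@K_sum _ _ (fun i x => (\1_(F i) x)%:E))//.
  by move=> i; apply/measurable_EFinP.
rewrite (_ : functional_measure _ =
  K (fun x => limn (fun n => \sum_(i <- index_iota 0 n) (\1_(F i) x)%:E))); last first.
  rewrite /functional_measure; congr K; apply/funext => x.
  by rewrite (indic_bigcup _ tF).
apply: (Klim (fun n x => \sum_(i <- index_iota 0 n) (\1_(F i) x)%:E)).
- by move=> n; apply: emeasurable_sum => i; apply/measurable_EFinP.
- by move=> n x; apply: sume_ge0 => i _; rewrite lee_fin.
- by move=> x; apply: ereal_nondecreasing_series => i _ _; rewrite lee_fin.
Qed.

HB.instance Definition _ := isMeasure.Build _ _ _ functional_measure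
  mu0 mu_ge0 mu_sigma.

(** Both sides are continuous along increasing sequences, so [f] may be replaced by simple
    functions; on these, additivity and homogeneity reduce the formula to the definition of
    [functional_measure]. *)
Lemma functional_measureE (f : S -> \bar R) : measurable_fun setT f ->
  (forall x, 0 <= f x) -> K f = \int[functional_measure]_x f x.
Proof.
move=> mf f0; pose h := nnsfun_approx measurableT mf.
have hlim x : limn (fun n => (h n x)%:E) = f x.
  by apply/cvg_lim => //; exact: cvg_nnsfun_approx.
case: KP => _ KZ _ Klim.
have mh n : measurable_fun setT (EFin \o h n) by exact/measurable_EFinP.
have h0 n x : 0 <= (EFin \o h n) x by rewrite lee_fin.
have ndh x : nondecreasing_seq ((fun n => EFin \o h n) ^~ x).
  by move=> a b ab; rewrite lee_fin; exact/lefP/nd_nnsfun_approx.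
have := Klim _ mh h0 ndh; rewrite (_ : (fun x => limn _) = f); last first.
  by apply/funext => x; exact: hlim.
move/cvg_lim => <- //.
have := @cvg_monotone_convergence _ _ _ functional_measure _ measurableT _ mh
  (fun n x _ => h0 n x) (fun x _ => ndh x).
move/cvg_lim; under eq_integral do rewrite hlim.
move=> <- //; congr (limn _); apply/funext => n /=.
rewrite integralT_nnsfun sintegralE fsbig_finite//=.
transitivity (K (fun x => \sum_(r <- fset_set (range (h n)))
   (fun r x => (r * \1_(h n @^-1` [set r]) x)%:E) r x)).
  congr K; apply/funext => x /=.
  by rewrite [in LHS]fimfunE fsbig_finite//= sumEFin.
rewrite K_sum; last 2 first.
- move=> r; apply/measurable_EFinP; exact: measurable_funM.
- move=> r x; exact: nnfun_muleindic_ge0.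
apply: eq_bigr => r _.
(* Homogeneity is available for nonnegative constants only; a negative [r] is not a value of [h n],
   so its level set is empty and both terms vanish. *)
have [r0|r0] := leP 0%R r; first last.
  rewrite preimage_nnfun0// mu0 mule0 -[RHS]K0; congr K.
  by apply/funext => x; rewrite indic0 mulr0.
rewrite -KZ//.
by apply/measurable_EFinP.
Qed.

End functional_measure.

(** Both functionals are integrals against measures, so uniqueness of a finite measure on a
    generating family closed under intersection applies. Finiteness of [K2 (cst 1)] follows from
    that of [K1 (cst 1)], as [C] contains [setT]. *)
Lemma eq_positive_functional {d} {S : measurableType d} {R : realType}
    (C : set (set S)) (K1 K2 : (S -> \bar R) -> \bar R) :
  positive_functional K1 -> positive_functional K2 ->
  measurable = <<s C >> -> setI_closed C -> C setT ->
  K1 (cst 1) < +oo ->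
  (forall A, C A -> K1 (fun x => (\1_A x)%:E) = K2 (fun x => (\1_A x)%:E)) ->
  forall f, measurable_fun setT f -> (forall x, 0 <= f x) -> K1 f = K2 f.
Proof.
move=> P1 P2 mC CI CT fin1 E f mf f0.
rewrite (functional_measureE P1)// (functional_measureE P2)//.
apply: eq_measure_integral => A mA _.
apply: (g_sigma_algebra_measure_unique C _ (fun=> setT)) => //.
- by rewrite mC; exact: sub_sigma_algebra.
- by rewrite bigcup_const//; exists 0%N.
- move=> k; have E1 : functional_measure K1 setT = K1 (cst 1).
    by congr K1; apply/funext => x; rewrite indicT.
  by move: fin1; rewrite -E1.
- by rewrite -mC.
Qed.

(** Finiteness of [g] lets the product with [g] pass to increasing limits, which may be infinite. *)
Lemma positive_functional_weight {dO d} {O : measurableType dO}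
    {S : measurableType d} {R : realType} (mu : {measure set O -> \bar R})
    (U : O -> S) (g : O -> \bar R) :
  measurable_fun setT U -> measurable_fun setT g -> (forall w, 0 <= g w) ->
  (forall w, g w \is a fin_num) ->
  positive_functional (fun f : S -> \bar R => \int[mu]_w (f (U w) * g w)).
Proof.
move=> mU mg g0 gfin.
have mfU (f : S -> \bar R) : measurable_fun setT f -> measurable_fun setT (fun w => f (U w)).
  by move=> mf; exact: measurableT_comp mf mU.
split.
- by move=> f f0; apply: integral_ge0 => w _; rewrite mule_ge0.
- move=> c f c0 mf f0; rewrite -ge0_integralZl//.
  + by apply: eq_integral => w _; rewrite muleA.
  + exact: emeasurable_funM (mfU _ mf) mg.
  + by move=> w _; rewrite mule_ge0.
- move=> f1 f2 mf1 f10 mf2 f20; rewrite -ge0_integralD//.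
  + by apply: eq_integral => w _; rewrite ge0_muleDl.
  + by move=> w _; rewrite mule_ge0.
  + exact: emeasurable_funM (mfU _ mf1) mg.
  + by move=> w _; rewrite mule_ge0.
  + exact: emeasurable_funM (mfU _ mf2) mg.
- move=> f mf f0 ndf.
  have cf x : cvgn (f ^~ x) by exact: ereal_nondecreasing_is_cvgn.
  have nd w : nondecreasing_seq (fun n => f n (U w) * g w).
    by move=> a b ab; apply: lee_wpmul2r => //; exact: ndf.
  rewrite (_ : \int[mu]_w _ = \int[mu]_w limn (fun n => f n (U w) * g w)); last first.
    by apply: eq_integral => w _; rewrite limeMr.
  apply: cvg_monotone_convergence => //.
  + by move=> n; exact: emeasurable_funM (mfU _ (mf n)) mg.
  + by move=> n w _; rewrite mule_ge0.
Qed.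

Lemma positive_functional_kernel {dO d} {O : measurableType dO}
    {S : measurableType d} {R : realType} (mu : {measure set O -> \bar R})
    (k : R.-sfker O ~> S) :
  positive_functional (fun f : O * S -> \bar R => \int[mu]_w \int[k w]_x f (w, x)).
Proof.
have mf2 (f : O * S -> \bar R) w : measurable_fun setT f ->
    measurable_fun setT (fun x => f (w, x)).
  by move=> mf; apply: measurableT_comp mf _; exact: measurable_pair1.
have mk (f : O * S -> \bar R) : measurable_fun setT f -> (forall x, 0 <= f x) ->
    measurable_fun setT (fun w => \int[k w]_x f (w, x)).
  by move=> mf f0; exact: measurable_fun_integral_sfinite_kernel.
split.
- by move=> f f0; do 2 apply: integral_ge0 => ? _.
- move=> c f c0 mf f0; rewrite -ge0_integralZl//.
  + by apply: eq_integral => w _; rewrite ge0_integralZl//; exact: mf2.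
  + exact: mk.
  + by move=> w _; exact: integral_ge0.
- move=> f g mf f0 mg g0; rewrite -ge0_integralD//.
  + by apply: eq_integral => w _; rewrite ge0_integralD//; exact: mf2.
  + by move=> w _; exact: integral_ge0.
  + exact: mk.
  + by move=> w _; exact: integral_ge0.
  + exact: mk.
- move=> f mf f0 ndf.
  have ndk w : nondecreasing_seq (fun n => \int[k w]_x f n (w, x)).
    by move=> a b ab; apply: ge0_le_integral => //; [exact: mf2|exact: mf2|move=> x _; exact: ndf].
  rewrite (_ : \int[mu]_w _ = \int[mu]_w limn (fun n => \int[k w]_x f n (w, x))); last first.
    apply: eq_integral => w _; rewrite monotone_convergence//.
    + by move=> n; exact: mf2.
  apply: cvg_monotone_convergence => //.
  + by move=> n; exact: mk.
  + by move=> n w _; exact: integral_ge0.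
Qed.

Lemma integral_indic_weight {dO} {O : measurableType dO} {R : realType}
    (mu : {measure set O -> \bar R}) (B : set O) (g : O -> \bar R) :
  measurable B -> \int[mu]_(w in B) g w = \int[mu]_w ((\1_B w)%:E * g w).
Proof.
move=> mB; rewrite integral_mkcond; apply: eq_integral => w _.
rewrite patchE indicE; case: ifPn => _; by rewrite ?mul1e ?mul0e.
Qed.

Lemma integral_weight_eq {dO d} {O : measurableType dO}
    {S : measurableType d} {R : realType} (mu1 mu2 : {measure set O -> \bar R})
    (C : set (set S)) (U : O -> S) (g1 g2 : O -> \bar R) (f : S -> \bar R) :
  measurable = <<s C >> -> setI_closed C -> C setT ->
  measurable_fun setT U ->
  measurable_fun setT g1 -> (forall w, 0 <= g1 w) -> (forall w, g1 w \is a fin_num) ->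
  measurable_fun setT g2 -> (forall w, 0 <= g2 w) -> (forall w, g2 w \is a fin_num) ->
  \int[mu1]_w g1 w < +oo ->
  (forall A, C A -> \int[mu1]_(w in U @^-1` A) g1 w = \int[mu2]_(w in U @^-1` A) g2 w) ->
  measurable_fun setT f -> (forall x, 0 <= f x) ->
  \int[mu1]_w (f (U w) * g1 w) = \int[mu2]_w (f (U w) * g2 w).
Proof.
move=> mC CI CT mU mg1 g10 fg1 mg2 g20 fg2 fin E mf f0.
have mpre A : measurable A -> measurable (U @^-1` A).
  by move=> mA; rewrite -[X in measurable X]setTI; exact: mU.
have P1 := positive_functional_weight mu1 mU mg1 g10 fg1.
have P2 := positive_functional_weight mu2 mU mg2 g20 fg2.
apply: (eq_positive_functional P1 P2 mC CI CT _ _ mf f0).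
  by under eq_integral do rewrite mul1e.
move=> A CA.
have mA : measurable A by rewrite mC; exact: sub_sigma_algebra.
have := E _ CA.
by rewrite (integral_indic_weight mu1 _ (mpre _ mA)) (integral_indic_weight mu2 _ (mpre _ mA)).
Qed.

(** * Sub-sigma-algebras *)

Lemma measurable_wrtP {O : pointedType} {d} {S : measurableType d}
    (G : set (set O)) (f : O -> S) : sigma_algebra setT G ->
  measurable_wrt G f <-> measurable_fun setT (f : g_sigma_algebraType G -> S).
Proof.
move=> sG; split=> [mf _ B mB|mf B mB].
  rewrite setTI; apply: sub_sigma_algebra; exact: mf.
by have := mf measurableT B mB; rewrite setTI measurable_g_measurableTypeE.
Qed.

Lemma measurable_wrt_measurable {d1 d2} {O : measurableType d1} {S : measurableType d2}
    (G : set (set O)) (f : O -> S) : G `<=` measurable -> measurable_wrt G f ->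
  measurable_fun setT f.
Proof. by move=> Gm mf _ B mB; rewrite setTI; exact/Gm/mf. Qed.

Lemma measurable_wrt_sub {O : Type} {d2} {S : measurableType d2}
    (G G' : set (set O)) (f : O -> S) : G `<=` G' -> measurable_wrt G f ->
  measurable_wrt G' f.
Proof. by move=> GG' mf B mB; exact/GG'/mf. Qed.

Lemma measurable_wrt_comp {O : Type} {d1 d2} {S : measurableType d1} {S' : measurableType d2}
    (G : set (set O)) (f : O -> S) (g : S -> S') : measurable_fun setT g ->
  measurable_wrt G f -> measurable_wrt G (g \o f).
Proof.
move=> mg mf B mB; apply: (mf (g @^-1` B)).
by rewrite -[X in measurable X]setTI; exact: mg.
Qed.

Lemma measurable_id_sub {d} {O : measurableType d} (G : set (set O)) :
  <<s G >> `<=` measurable ->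
  measurable_fun setT (id : O -> g_sigma_algebraType G).
Proof. by move=> Gm _ B mB; rewrite setTI; exact: Gm. Qed.

Lemma measurable_preimageT {d1 d2} {O : measurableType d1} {S : measurableType d2}
  (f : O -> S) A : measurable_fun setT f -> measurable A -> measurable (f @^-1` A).
Proof. by move=> mf mA; rewrite -[X in measurable X]setTI; exact: mf. Qed.

(** With [mu1 = mu2] this is the rule for taking a known factor out of a conditional expectation:
    weights that agree on the events of [C] are interchangeable under every nonnegative factor
    measurable for [<<s C >>]. *)
Lemma integral_weight_sub {dO} {O : measurableType dO} {R : realType}
    (mu1 mu2 : {measure set O -> \bar R}) (C : set (set O))
    (g1 g2 : O -> \bar R) (f : O -> \bar R) :
  C `<=` measurable -> setI_closed C -> C setT ->
  measurable_fun setT g1 -> (forall w, 0 <= g1 w) -> (forall w, g1 w \is a fin_num) ->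
  measurable_fun setT g2 -> (forall w, 0 <= g2 w) -> (forall w, g2 w \is a fin_num) ->
  \int[mu1]_w g1 w < +oo ->
  (forall A, C A -> \int[mu1]_(w in A) g1 w = \int[mu2]_(w in A) g2 w) ->
  measurable_wrt <<s C >> f -> (forall x, 0 <= f x) ->
  \int[mu1]_w (f w * g1 w) = \int[mu2]_w (f w * g2 w).
Proof.
move=> Cm CI CT mg1 g10 fg1 mg2 g20 fg2 fin E mf f0.
apply: (@integral_weight_eq _ _ O (g_sigma_algebraType C) R mu1 mu2 C id g1 g2 f) => //.
- apply: measurable_id_sub; apply: smallest_sub => //.
  exact: sigma_algebra_measurable.
- by move=> _ B mB; rewrite setTI; exact: mf.
Qed.

Lemma density_integral {dO} {O : measurableType dO} {R : realType}
    (P Q : probability O R) (G : set (set O)) (m : O -> R) (f : O -> \bar R) :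
  sigma_algebra setT G -> G `<=` measurable -> density_on G P Q m ->
  measurable_wrt G f -> (forall x, 0 <= f x) ->
  \int[P]_w f w = \int[Q]_w (f w * (m w)%:E).
Proof.
move=> sG Gm [mm m0 mE] mf f0.
have GI : setI_closed G.
  move=> A B GA GB; rewrite -(measurable_g_measurableTypeE sG).
  by apply: measurableI; rewrite measurable_g_measurableTypeE.
have GT : G setT.
  by rewrite -(measurable_g_measurableTypeE sG); exact: measurableT.
transitivity (\int[P]_w (f w * cst 1 w)).
  by apply: eq_integral => w _; rewrite mule1.
apply: (@integral_weight_sub _ O R P Q G) => //.
- apply/measurable_EFinP; exact: measurable_wrt_measurable mm.
- rewrite integral_cst// mul1e ltey_eq; by rewrite fin_num_measure.
- by move=> A GA; rewrite integral_cst ?mul1e ?mE//; exact: Gm.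
- by rewrite (sigma_algebra_id sG).
Qed.

(** Radon-Nikodym is applied to the image laws on [S], so the density comes out as a function of [U]
    and needs no separate factorisation through it. *)
Lemma statistic_density {dO d} {O : measurableType dO} {S : measurableType d}
    {R : realType} (P Q : probability O R) (U : O -> S) :
  measurable_fun setT U ->
  (forall A, measurable A -> Q (U @^-1` A) = 0 -> P (U @^-1` A) = 0) ->
  exists m : S -> R, [/\ measurable_fun setT m, forall s, (0 <= m s)%R &
    forall A, measurable A -> P (U @^-1` A) = \int[Q]_(w in U @^-1` A) (m (U w))%:E].
Proof.
move=> mU PQ.
pose U' : {mfun O >-> S} := HB.pack U (isMeasurableFun.Build _ _ _ _ U mU).
pose P' : probability S R := distribution P U'.
pose Q' : probability S R := distribution Q U'.
have PQ' : P' `<< Q'.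
  apply/null_content_dominatesP => A mA.
  exact: PQ.
have [f [f0 ffin fi fE]] := radon_nikodym_sigma_finite PQ'.
have mf : measurable_fun setT f by exact: measurable_int fi.
exists (fine \o f); split.
- exact: measurableT_comp mf.
- by move=> s; exact/fine_ge0/f0.
- move=> A mA; rewrite -[LHS]/(P' A) fE//.
  rewrite /Q' /distribution (ge0_integral_pushforward mU _ mA) //; last first.
    exact: measurable_funTS.
  by apply: eq_integral => w _ /=; rewrite fineK.
Qed.

(** * Hidden Markov models *)

Section sigma_upto_theory.
Context {dO dS} {O : measurableType dO} {S : measurableType dS}.
Implicit Types F : nat -> O -> S.

Lemma sigma_algebra_sigma_upto F n : sigma_algebra setT (sigma_upto F n).
Proof. exact: smallest_sigma_algebra. Qed.

Lemma measurable_wrt_sigma_upto F i n : (i <= n)%N ->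
  measurable_wrt (sigma_upto F n) (F i).
Proof.
move=> ilen B mB; apply: sub_sigma_algebra; exists i => //.
by exists B => //; rewrite setTI.
Qed.

Lemma sigma_upto_sub F n (G : set (set O)) : sigma_algebra setT G ->
  (forall i, (i <= n)%N -> measurable_wrt G (F i)) -> sigma_upto F n `<=` G.
Proof.
move=> sG mF; apply: smallest_sub => // A [i /= ilen [B mB <-]].
by rewrite setTI; exact: mF.
Qed.

Lemma sigma_upto_le F m n : (m <= n)%N -> sigma_upto F m `<=` sigma_upto F n.
Proof.
move=> mn; apply: sigma_upto_sub; first exact: sigma_algebra_sigma_upto.
by move=> i im; apply: measurable_wrt_sigma_upto; exact: leq_trans mn.
Qed.

Lemma sigma_upto_measurable F n : (forall i, measurable_fun setT (F i)) ->
  sigma_upto F n `<=` measurable.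
Proof.
move=> mF; apply: sigma_upto_sub; first exact: sigma_algebra_measurable.
by move=> i _ B mB; exact: measurable_preimageT.
Qed.
End sigma_upto_theory.

Lemma sigma_algebra_setI {O : pointedType} (G : set (set O)) : sigma_algebra setT G ->
  setI_closed G.
Proof.
move=> sG A B GA GB; rewrite -(measurable_g_measurableTypeE sG).
by apply: measurableI; rewrite measurable_g_measurableTypeE.
Qed.

Lemma sigma_algebra_setT {O : pointedType} (G : set (set O)) : sigma_algebra setT G ->
  G setT.
Proof.
by move=> sG; rewrite -(measurable_g_measurableTypeE sG); exact: measurableT.
Qed.

Lemma measurable_wrt_indicM {O : pointedType} {R : realType} (G : set (set O)) A
    (f : O -> \bar R) : sigma_algebra setT G -> G A -> measurable_wrt G f ->
  measurable_wrt G (fun w => (\1_A w)%:E * f w).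
Proof.
move=> sG GA /(measurable_wrtP _ sG) mf; apply/(measurable_wrtP _ sG).
apply: emeasurable_funM => //; apply/measurable_EFinP.
by apply: measurable_indic; rewrite measurable_g_measurableTypeE.
Qed.

Section hmm.
Context {R : realType} {dX dZ dO : measure_display}
  {X : measurableType dX} {Z : measurableType dZ} {O : measurableType dO}
  (T : R.-pker X ~> X) (q : probability Z R)
  (Xs : nat -> O -> X) (Zs : nat -> O -> Z).
Hypotheses (mX : forall n, measurable_fun setT (Xs n))
  (mZ : forall n, measurable_fun setT (Zs n)).

Definition noise_event (B : nat -> set Z) n :=
  \bigcap_(i in `I_n.+1) (Zs i @^-1` B i).

Let noise_event_setT n : noise_event (fun=> setT) n = setT.
Proof. by apply/seteqP; split. Qed.

(** These are the events whose probability [hmm_law] factorises. They are closed under intersection,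
    so identities for the joint history of states and noises are tested on them. *)
Definition joint_cylinders n : set (set O) :=
  [set A | exists G B, [/\ sigma_upto Xs n G, forall i, measurable (B i) &
    A = G `&` noise_event B n]].

Definition joint_history n := <<s joint_cylinders n >>.

Let measurable_noise_event B n : (forall i, measurable (B i)) ->
  measurable (noise_event B n).
Proof.
by move=> mB; apply: bigcap_measurableType => // i _; exact: measurable_preimageT.
Qed.

Let joint_cylinders_measurable n : joint_cylinders n `<=` measurable.
Proof.
move=> _ [G [B [GX mB ->]]]; apply: measurableI.
  exact: sigma_upto_measurable GX.
exact: measurable_noise_event.
Qed.

Lemma joint_history_measurable n : joint_history n `<=` measurable.
Proof. by apply: smallest_sub => //; exact: sigma_algebra_measurable. Qed.

Let sub_joint_history n G : sigma_upto Xs n G -> joint_history n G.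
Proof.
move=> GX; apply: sub_sigma_algebra; exists G, (fun=> setT); split => //.
by rewrite noise_event_setT setIT.
Qed.

Lemma measurable_wrt_joint_X i n : (i <= n)%N -> measurable_wrt (joint_history n) (Xs i).
Proof. by move=> ilen B mB; apply: sub_joint_history; exact: measurable_wrt_sigma_upto. Qed.

Lemma measurable_wrt_joint_Z i n : (i <= n)%N -> measurable_wrt (joint_history n) (Zs i).
Proof.
move=> ilen B mB; apply: sub_sigma_algebra.
exists setT, (fun j => if j == i then B else setT); split.
- exact: sigma_algebra_setT (sigma_algebra_sigma_upto _ _).
- by move=> j; case: ifP.
- rewrite setTI; apply/seteqP; split=> w /=.
    by move=> Bw j _ /=; case: eqP => // ->.
  by move=> /(_ i ilen) /=; rewrite eqxx.
Qed.

Lemma joint_history_le m n : (m <= n)%N -> joint_history m `<=` joint_history n.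
Proof.
move=> mn; have sJ : sigma_algebra setT (joint_history n) by exact: smallest_sigma_algebra.
apply: smallest_sub => // _ [G [B [GX mB ->]]].
apply: (sigma_algebra_setI sJ).
  by apply: sub_joint_history; exact: sigma_upto_le GX.
rewrite -(measurable_g_measurableTypeE sJ).
apply: bigcap_measurableType => // i /= im; rewrite (measurable_g_measurableTypeE sJ).
by apply: measurable_wrt_joint_Z => //; exact: leq_trans mn.
Qed.

Let joint_cylinders_setI n : setI_closed (joint_cylinders n).
Proof.
move=> _ _ [G [B [GX mB ->]]] [G' [B' [GX' mB' ->]]].
exists (G `&` G'), (fun i => B i `&` B' i); split.
- exact: (sigma_algebra_setI (sigma_algebra_sigma_upto Xs n) GX GX').
- by move=> i; exact: measurableI.
- rewrite setIACA; congr (_ `&` _); apply/seteqP; split=> w.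
    by move=> [H1 H2] i im; split; [exact: H1|exact: H2].
  by move=> H; split=> i im; have [] := H i im.
Qed.

Let joint_cylinders_setT n : joint_cylinders n setT.
Proof.
exists setT, (fun=> setT); split => //.
  exact: sigma_algebra_setT (sigma_algebra_sigma_upto _ _).
by rewrite noise_event_setT setIT.
Qed.

Context (P : probability O R) (init : probability X R).
Hypothesis lawP : hmm_law T q Xs Zs P init.

Lemma noise_indep n (B : nat -> set Z) (f : O -> \bar R) :
  (forall i, measurable (B i)) -> measurable_wrt (sigma_upto Xs n) f ->
  (forall w, 0 <= f w) ->
  \int[P]_w (f w * (\1_(noise_event B n) w)%:E) =
  (\int[P]_w f w) * \prod_(i < n.+1) q (B i).
Proof.
move=> mB mf f0; case: lawP => _ _ ind.
have sX := sigma_algebra_sigma_upto Xs n.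
have mXn := sigma_upto_measurable (n := n) mX.
have q0 : 0 <= \prod_(i < n.+1) q (B i) by apply: prode_ge0 => i _.
have qfin : \prod_(i < n.+1) q (B i) \is a fin_num.
  by apply: prode_fin_num => i _; exact: fin_num_measure.
have := @integral_weight_sub _ O R P P (sigma_upto Xs n)
  (fun w => (\1_(noise_event B n) w)%:E) (cst (\prod_(i < n.+1) q (B i))) f
  mXn (sigma_algebra_setI sX) (sigma_algebra_setT sX).
move=> ->//.
- by rewrite ge0_integralZr//; exact: measurable_wrt_measurable mf.
- by apply/measurable_EFinP; apply: measurable_indic; exact: measurable_noise_event.
- rewrite integral_indic//; last exact: measurable_noise_event.
  by rewrite setIT ltey_eq fin_num_measure//; exact: measurable_noise_event.
- move=> A AX; rewrite integral_indic; [|exact: mXn|exact: measurable_noise_event].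
  by rewrite integral_cst; [rewrite setIC muleC; exact: ind|exact: mXn].
- by rewrite (sigma_algebra_id sX).
Qed.

(** The law gives the Markov property relative to past states only. Past noises can be added because
    on a cylinder they split off as a constant factor, by independence from the whole state
    process. *)
Lemma markov_noise n (B : set X) (C : set Z) (f : O -> \bar R) :
  measurable B -> measurable C ->
  measurable_wrt (joint_history n) f -> (forall w, 0 <= f w) ->
  \int[P]_w (f w * (\1_(Xs n.+1 @^-1` B `&` Zs n.+1 @^-1` C) w)%:E) =
  \int[P]_w (f w * (T (Xs n w) B * q C)).
Proof.
move=> mB mC mf f0; case: lawP => _ mark ind.
have mBC : measurable (Xs n.+1 @^-1` B `&` Zs n.+1 @^-1` C).
  by apply: measurableI; exact: measurable_preimageT.
have mTX : measurable_fun setT (fun w => T (Xs n w) B).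
  exact: (measurableT_comp (measurable_kernel T B mB) (mX n)).
have fTX w : T (Xs n w) B \is a fin_num by exact: finite_kernel_measure.
have mTXq : measurable_fun setT (fun w => T (Xs n w) B * q C).
  exact: (emeasurable_funM mTX (@measurable_cst _ _ _ _ _ _)).
apply: (@integral_weight_sub _ O R P P (joint_cylinders n)) => //.
- by apply/measurable_EFinP; exact: measurable_indic.
- by move=> w; rewrite mule_ge0.
- by move=> w; rewrite fin_numM// fin_num_measure.
- by rewrite integral_indic// setIT ltey_eq fin_num_measure.
move=> A [G [D [GX mD ->]]].
have mG : measurable G by exact: sigma_upto_measurable GX.
have mA : measurable (G `&` noise_event D n).
  by apply: measurableI => //; exact: measurable_noise_event.
(* Placing [C] at index [n.+1] merges the new constraint with the past ones into a single noise
   event, while [G] and the next state form an event of the states up to [n.+1]. *)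
pose D' i := if i == n.+1 then C else D i.
rewrite integral_indic//.
rewrite (_ : _ `&` _ = (G `&` Xs n.+1 @^-1` B) `&` noise_event D' n.+1); last first.
  apply/seteqP; split=> w /=.
    move=> [[XB ZC] [Gw Dw]]; split=> // i /= ii; rewrite /D' /=.
    case: eqP => [->//|/eqP ni]; apply: Dw.
    by move: ii; rewrite /= ltnS leq_eqVlt (negbTE ni).
  move=> [[Gw XB] Dw]; have := Dw n.+1 (ltnSn _); rewrite /= /D' eqxx => ZC.
  split=> //; split=> // i /= ii; have := Dw i (ltnW ii).
  by rewrite /= /D' ltn_eqF.
have GB : sigma_upto Xs n.+1 (G `&` Xs n.+1 @^-1` B).
  apply: (sigma_algebra_setI (sigma_algebra_sigma_upto Xs n.+1)).
    exact: sigma_upto_le GX.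
  exact: measurable_wrt_sigma_upto.
have mD' i : measurable (D' i) by rewrite /D'; case: ifP.
rewrite [X in X = _](ind _ _ _ GB mD').
rewrite mark// big_ord_recr/= {2}/D' eqxx.
rewrite (eq_bigr (fun i : 'I_n.+1 => q (D i))); last first.
  by move=> i _; rewrite /D' ltn_eqF.
rewrite integral_indic_weight// [RHS]integral_indic_weight//.
transitivity ((\int[P]_w ((\1_G w)%:E * T (Xs n w) B * q C)) * \prod_(i < n.+1) q (D i)).
  rewrite ge0_integralZr//.
  - by rewrite muleA muleAC.
  - apply: emeasurable_funM => //; apply/measurable_EFinP; exact: measurable_indic.
(* The constant contributed by the past noises is turned back into the indicator of their event; the
   remaining weight depends on the states up to [n] alone. *)
rewrite -noise_indep//.
- apply: eq_integral => w _.
  rewrite indicI /= EFinM -!muleA. congr (_ * _). by rewrite muleA muleC.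
- have sX := sigma_algebra_sigma_upto Xs n.
  apply/(measurable_wrtP _ sX); apply: emeasurable_funM => //.
  apply/(measurable_wrtP _ sX); apply: measurable_wrt_indicM => //.
  apply: (measurable_wrt_comp (measurable_kernel T B mB)).
  exact: measurable_wrt_sigma_upto.
- by move=> w; rewrite !mule_ge0.
Qed.
End hmm.

(** The invariant of the induction on time. [G] may have forgotten earlier states, but it must know
    [Xs k], so that the next transition probability is [G]-measurable. *)
Definition markov_field {R : realType} {dX dZ dO}
  {X : measurableType dX} {Z : measurableType dZ} {O : measurableType dO}
  (Xs : nat -> O -> X) (Zs : nat -> O -> Z) (P Q : probability O R)
  (k : nat) (G : set (set O)) (m : O -> R) : Prop :=
  [/\ sigma_algebra setT G, G `<=` joint_history Xs Zs k,
      measurable_wrt G (Xs k) & density_on G P Q m].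

(** * Change of law along the chain *)

Section change_of_law.
Context {R : realType} {dX dZ dO : measure_display}
  {X : measurableType dX} {Z : measurableType dZ} {O : measurableType dO}
  (T : R.-pker X ~> X) (q : probability Z R)
  (Xs : nat -> O -> X) (Zs : nat -> O -> Z).
Hypotheses (mX : forall n, measurable_fun setT (Xs n))
  (mZ : forall n, measurable_fun setT (Zs n)).
Context (P Q : probability O R) (mu nu : probability X R).
Hypotheses (lawP : hmm_law T q Xs Zs P mu) (lawQ : hmm_law T q Xs Zs Q nu).

Local Notation markov_field := (markov_field Xs Zs P Q).

Lemma density_on_generated (D : set (set O)) (m : O -> R) :
  D `<=` measurable -> setI_closed D -> D setT ->
  measurable_wrt <<s D >> m -> (forall w, 0 <= m w)%R ->
  (forall A, D A -> P A = \int[Q]_(w in A) (m w)%:E) ->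
  density_on <<s D >> P Q m.
Proof.
move=> Dm DI DT mm m0 E; split => // A DA.
have Gm : <<s D >> `<=` measurable.
  by apply: smallest_sub => //; exact: sigma_algebra_measurable.
have mA := Gm _ DA.
transitivity (\int[P]_w ((\1_A w)%:E * cst 1 w)).
  by under eq_integral do rewrite mule1; rewrite integral_indic// setIT.
rewrite integral_indic_weight//.
apply: (@integral_weight_sub _ O R P Q D) => //.
- by apply/measurable_EFinP; exact: measurable_wrt_measurable mm.
- by rewrite integral_cst// mul1e ltey_eq fin_num_measure.
- by move=> B DB; rewrite -(E _ DB) integral_cst ?mul1e//; exact: (Dm _ DB).
- apply: (@measurable_wrt_comp _ _ _ _ _ _ _ (EFin : R -> \bar R)) => //.
  apply/measurable_wrtP; first exact: smallest_sigma_algebra.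
  by apply: measurable_indic; rewrite /measurable/= sigma_algebra_id//; exact: smallest_sigma_algebra.
Qed.

Definition next_field (G : set (set O)) k :=
  <<s [set A | exists B C D, [/\ G B, measurable C, measurable D &
       A = B `&` (Xs k.+1 @^-1` C `&` Zs k.+1 @^-1` D)]] >>.

Lemma next_field_sub G k : G `<=` next_field G k.
Proof.
move=> A GA; apply: sub_sigma_algebra; exists A, setT, setT; split => //.
by rewrite !preimage_setT !setIT.
Qed.

Lemma next_field_X G k : sigma_algebra setT G -> measurable_wrt (next_field G k) (Xs k.+1).
Proof.
move=> sG B mB; apply: sub_sigma_algebra; exists setT, B, setT; split => //.
  exact: sigma_algebra_setT sG.
by rewrite preimage_setT setIT setTI.
Qed.

Lemma next_field_Z G k : sigma_algebra setT G -> measurable_wrt (next_field G k) (Zs k.+1).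
Proof.
move=> sG B mB; apply: sub_sigma_algebra; exists setT, setT, B; split => //.
  exact: sigma_algebra_setT sG.
by rewrite preimage_setT !setTI.
Qed.

(** Given the history up to [k], the next state and noise have the same conditional law under [P]
    and [Q]. One therefore conditions under [P], changes law on [G], and undoes the conditioning
    under [Q], with [m] untouched. *)
Lemma markov_field_next k G m : markov_field k G m ->
  markov_field k.+1 (next_field G k) m.
Proof.
move=> [sG GJ GX dm]; have [mm m0 mE] := dm.
have Gm : G `<=` measurable.
  by apply: subset_trans GJ _; exact: joint_history_measurable.
split; first exact: smallest_sigma_algebra.
- have sJ : sigma_algebra setT (joint_history Xs Zs k.+1) by exact: smallest_sigma_algebra.
  apply: smallest_sub => // _ [B [C [D [GB mC mD ->]]]].
  apply: (sigma_algebra_setI sJ).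
    by apply: (joint_history_le (leqnSn k)); exact: GJ.
  apply: (sigma_algebra_setI sJ); first exact: measurable_wrt_joint_X.
  exact: measurable_wrt_joint_Z.
- exact: next_field_X.
apply: density_on_generated => //.
- move=> _ [B [C [D [GB mC mD ->]]]]; apply: measurableI; first exact: Gm.
  by apply: measurableI; exact: measurable_preimageT.
- move=> _ _ [B [C [D [GB mC mD ->]]]] [B' [C' [D' [GB' mC' mD' ->]]]].
  exists (B `&` B'), (C `&` C'), (D `&` D'); split.
  + exact: (sigma_algebra_setI sG).
  + exact: measurableI.
  + exact: measurableI.
  + by rewrite !preimage_setI setIACA; congr (_ `&` _); rewrite setIACA.
- exists setT, setT, setT; split => //; first exact: sigma_algebra_setT.
  by rewrite !preimage_setT !setIT.
- by apply: measurable_wrt_sub mm; exact: next_field_sub.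
move=> _ [B [C [D [GB mC mD ->]]]].
have mB := Gm _ GB.
have mCD : measurable (Xs k.+1 @^-1` C `&` Zs k.+1 @^-1` D).
  by apply: measurableI; exact: measurable_preimageT.
have mEm : measurable_wrt G (EFin \o m) by exact: measurable_wrt_comp.
have m1 : measurable_wrt G (fun w => (\1_B w)%:E : \bar R).
  rewrite (_ : (fun w => _) = (fun w => (\1_B w)%:E * cst 1 w)); last first.
    by apply/funext => w; rewrite mule1.
  by apply: measurable_wrt_indicM => //; apply/(measurable_wrtP _ sG).
have mTX : measurable_wrt G (fun w => T (Xs k w) C).
  exact: (measurable_wrt_comp (measurable_kernel T C mC) GX).
transitivity (\int[P]_w ((\1_B w)%:E * (\1_(Xs k.+1 @^-1` C `&` Zs k.+1 @^-1` D) w)%:E)).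
  rewrite -[LHS]mul1e -integral_cst; last exact: measurableI.
  rewrite integral_indic_weight; last exact: measurableI.
  by apply: eq_integral => w _; rewrite mule1 indicI EFinM.
rewrite (markov_noise mX mZ lawP)//; last first.
  exact: measurable_wrt_sub GJ m1.
rewrite (density_integral sG Gm dm); last 2 first.
- apply: measurable_wrt_indicM => //; apply/(measurable_wrtP _ sG).
  by apply: emeasurable_funM => //; apply/(measurable_wrtP _ sG).
- by move=> w; rewrite !mule_ge0.
transitivity (\int[Q]_w (((\1_B w)%:E * (m w)%:E) * (T (Xs k w) C * q D))).
  by apply: eq_integral => w _; rewrite muleAC.
rewrite -(markov_noise mX mZ lawQ)//; last 2 first.
- apply: measurable_wrt_sub GJ _.
  exact: measurable_wrt_indicM.
- by move=> w; rewrite mule_ge0 ?lee_fin.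
rewrite [RHS]integral_indic_weight; last exact: measurableI.
by apply: eq_integral => w _; rewrite [in RHS]indicI /= EFinM muleAC.
Qed.

(** Both states and noises after [k] are recorded in [G'], since the later observations are
    functions of them. The bounds start strictly after [k] because [G] need not know earlier
    ones. *)
Lemma markov_field_iter k G m j : markov_field k G m ->
  exists G', [/\ markov_field (k + j) G' m, G `<=` G',
    forall i, (k < i <= k + j)%N -> measurable_wrt G' (Xs i)
  & forall i, (k < i <= k + j)%N -> measurable_wrt G' (Zs i)].
Proof.
move=> mG; elim: j => [|j [G' [mG' GG' G'X G'Z]]].
  rewrite addn0; exists G; split => // i /andP[ki ik];
    by have := leq_trans ki ik; rewrite ltnn.
have [sG' _ _ _] := mG'.
exists (next_field G' (k + j)); rewrite addnS; split.
- exact: markov_field_next.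
- by apply: subset_trans GG' _; exact: next_field_sub.
- move=> i /andP[ki]; rewrite leq_eqVlt => /predU1P[->|ij].
    exact: next_field_X.
  by apply: measurable_wrt_sub (G'X i _); [exact: next_field_sub|rewrite ki].
- move=> i /andP[ki]; rewrite leq_eqVlt => /predU1P[->|ij].
    exact: next_field_Z.
  by apply: measurable_wrt_sub (G'Z i _); [exact: next_field_sub|rewrite ki].
Qed.

Definition initial_field : set (set O) :=
  <<s [set A | exists C D, [/\ measurable C, measurable D &
       A = Xs 0 @^-1` C `&` Zs 0 @^-1` D]] >>.

Lemma initial_field_X : measurable_wrt initial_field (Xs 0).
Proof.
move=> B mB; apply: sub_sigma_algebra; exists B, setT; split => //.
by rewrite preimage_setT setIT.
Qed.

Lemma initial_field_Z : measurable_wrt initial_field (Zs 0).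
Proof.
move=> B mB; apply: sub_sigma_algebra; exists setT, B; split => //.
by rewrite preimage_setT setTI.
Qed.

(** The density is the derivative of [mu] by [nu] evaluated at [Xs 0]. Adding [Zs 0], on which the
    first observation depends, does not change it: that noise is independent of the state and has
    the same law under [P] and [Q]. *)
Lemma markov_field_init : mu `<< nu ->
  exists m, markov_field 0 initial_field m.
Proof.
move=> munu.
have [f [f0 ffin fi fE]] := radon_nikodym_sigma_finite munu.
have mf : measurable_fun setT f by exact: measurable_int fi.
have mff : measurable_fun setT (fine \o f) by exact: measurableT_comp mf.
exists (fine \o f \o Xs 0); split.
- exact: smallest_sigma_algebra.
- have sJ : sigma_algebra setT (joint_history Xs Zs 0) by exact: smallest_sigma_algebra.
  apply: smallest_sub => // _ [C [D [mC mD ->]]].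
  apply: (sigma_algebra_setI sJ); first exact: measurable_wrt_joint_X.
  exact: measurable_wrt_joint_Z.
- exact: initial_field_X.
apply: density_on_generated.
- move=> _ [C [D [mC mD ->]]]; apply: measurableI; exact: measurable_preimageT.
- move=> _ _ [C [D [mC mD ->]]] [C' [D' [mC' mD' ->]]].
  exists (C `&` C'), (D `&` D'); split; [exact: measurableI|exact: measurableI|].
  by rewrite !preimage_setI setIACA.
- by exists setT, setT; split => //; rewrite !preimage_setT setIT.
- exact: measurable_wrt_comp mff initial_field_X.
- by move=> w; exact/fine_ge0/f0.
move=> _ [C [D [mC mD ->]]].
have noise0 : noise_event Zs (fun=> D) 0 = Zs 0 @^-1` D.
  apply/seteqP; split=> w; first by apply.
  by move=> ZD i /=; rewrite ltnS leqn0 => /eqP ->.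
have sX := sigma_algebra_sigma_upto Xs 0.
have CX : sigma_upto Xs 0 (Xs 0 @^-1` C) by exact: measurable_wrt_sigma_upto.
have mXC := measurable_preimageT (mX 0%N) mC.
have mZD := measurable_preimageT (mZ 0%N) mD.
have m_wrt : measurable_wrt (sigma_upto Xs 0) (EFin \o (fine \o f \o Xs 0)).
  rewrite compA; apply: (measurable_wrt_comp (S := X)).
    exact/measurable_EFinP.
  exact: measurable_wrt_sigma_upto.
transitivity (mu C * q D).
  case: lawP => initP _ indP.
  have := indP 0%N _ (fun=> D) CX (fun=> mD).
  by rewrite -/(noise_event _ (fun=> D) 0) noise0 big_ord_recr big_ord0 /= mul1e initP.
rewrite integral_indic_weight; last exact: measurableI.
transitivity (\int[Q]_w (((\1_(Xs 0 @^-1` C) w)%:E * (EFin \o (fine \o f \o Xs 0)) w) *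
    (\1_(noise_event Zs (fun=> D) 0) w)%:E)); last first.
  by apply: eq_integral => w _; rewrite noise0 indicI /= EFinM muleAC.
rewrite (noise_indep mX mZ lawQ) //; last 2 first.
- exact: measurable_wrt_indicM.
- by move=> w; rewrite mule_ge0 ?lee_fin//; exact/fine_ge0/f0.
rewrite big_ord_recr big_ord0 /= mul1e; congr (_ * _).
rewrite -integral_indic_weight// fE//.
transitivity (\int[pushforward Q (Xs 0)]_(x in C) f x).
  apply: eq_measure_integral => A mA _.
  by case: lawQ => initQ _ _; exact: esym (initQ _ mA).
rewrite (ge0_integral_pushforward (mX 0%N) _ mC) //; last exact: measurable_funTS.
by apply: eq_integral => w _ /=; rewrite fineK.
Qed.

Lemma markov_field_full n : mu `<< nu -> exists G m, [/\ markov_field n G m,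
    forall i, (i <= n)%N -> measurable_wrt G (Xs i)
  & forall i, (i <= n)%N -> measurable_wrt G (Zs i)].
Proof.
move=> /markov_field_init[m /(markov_field_iter n)]; rewrite add0n.
move=> [G [mG iG GX GZ]]; exists G, m; split => //.
- move=> [_|i ilen]; last exact: GX.
  exact: measurable_wrt_sub iG initial_field_X.
- move=> [_|i ilen]; last exact: GZ.
  exact: measurable_wrt_sub iG initial_field_Z.
Qed.

End change_of_law.

(** * Countable generation of standard Borel spaces *)

Definition rational_ray (R : realType) (n : nat) : set R :=
  `]ratr (odflt 0%R (choice.unpickle n : option rat)), +oo[%classic.

Lemma setI_closed_rational_ray (R : realType) :
  setI_closed (range (@rational_ray R)).
Proof.
move=> _ _ [i _ <-] [j _ <-].
set a := odflt 0%R (choice.unpickle i : option rat).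
set b := odflt 0%R (choice.unpickle j : option rat).
exists (choice.pickle (Num.max a b)) => //; rewrite /rational_ray choice.pickleK /=.
apply/seteqP; split=> x /=; rewrite !in_itv/= !andbT.
  rewrite -/a -/b; case: (leP a b) => ab xab; split => //.
    by apply: le_lt_trans xab; rewrite ler_rat.
  by apply: le_lt_trans xab; rewrite ler_rat ltW.
by rewrite -/a -/b => -[xa xb]; case: (leP a b).
Qed.

Lemma measurable_rational_rays (R : realType) :
  measurable = <<s range (@rational_ray R) >>.
Proof.
apply/seteqP; split; last first.
  apply: smallest_sub; first exact: sigma_algebra_measurable.
  by move=> _ [n _ <-]; exact: measurable_itv.
have -> : (measurable : set (set R)) = <<s @RGenOInfty.G R >>.
  exact: RGenOInfty.measurableE.
apply: smallest_sub; first exact: smallest_sigma_algebra.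
move=> _ [x ->].
(* A code that decodes to no rational stands for [0]; it repeats the ray already given by the code
   of [0], so it does no harm. *)
pose D := [set n | (x <= ratr (odflt 0%R (choice.unpickle n : option rat)) :> R)%R].
rewrite (_ : `]x, +oo[%classic = \bigcup_(n in D) @rational_ray R n).
  apply: (@bigcup_measurable _ (g_sigma_algebraType (range (@rational_ray R)))) => n _.
  by apply: sub_sigma_algebra; exists n.
apply/seteqP; split=> y /=; rewrite in_itv/= andbT.
  move=> xy; have [r /[!in_itv]/= /andP[xr ry]] := rat_in_itvoo xy.
  exists (choice.pickle r); rewrite /D /rational_ray /= choice.pickleK /=; first exact: ltW.
  by rewrite in_itv/= andbT.
by move=> [n xn]; rewrite /rational_ray /= in_itv/= andbT; exact: le_lt_trans.
Qed.

(** Countability is the point: an identity that holds almost surely for each event of the family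
    holds almost surely for all of them at once. Each measurable set is the preimage of its image,
    by injectivity of [f], so pulling back the rational rays generates the whole field. *)
Lemma standard_borel_pi_system {R : realType} {d} {X : measurableType d} :
  standard_borel R X -> exists A : nat -> set X,
    setI_closed (range A) /\ measurable = <<s range A >>.
Proof.
move=> [f [mf injf _ mfimg]]; exists (fun n => f @^-1` @rational_ray R n); split.
  move=> _ _ [i _ <-] [j _ <-].
  have [k _ kE] := @setI_closed_rational_ray R _ _ (imageT _ i) (imageT _ j).
  by exists k => //; rewrite kE preimage_setI.
have -> : range (fun n => f @^-1` @rational_ray R n) =
    preimage_set_system setT f (range (@rational_ray R)).
  apply/seteqP; split=> [_ [n _ <-]|_ [_ [n _ <-] <-]].
    by exists (@rational_ray R n) => //; rewrite setTI.
  by exists n => //; rewrite setTI.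
rewrite g_sigma_preimageE.
have -> : (range (@rational_ray R)).-sigma.-measurable = (measurable : set (set R)).
  by rewrite measurable_rational_rays.
apply/seteqP; split=> [A mA|_ [B mB <-]].
  exists (f @` A); first exact: mfimg.
  rewrite setTI; apply/seteqP; split=> x /=; last by exists x.
  by move=> [y Ay /injf <-].
exact: mf.
Qed.

Section subfield.
Context {dO} {O : measurableType dO} {R : realType} (C : set (set O)).
Hypothesis Cm : <<s C >> `<=` measurable.
Local Notation OC := (g_sigma_algebraType C).

Let idm : {mfun O >-> OC} := HB.pack (id : O -> OC)
  (isMeasurableFun.Build _ _ _ _ (id : O -> OC) (measurable_id_sub Cm)).

(** The restriction of [P] to [<<s C >>], written as the image under the identity into the coarser
    space. *)
Definition subfield_law (P : probability O R) : probability OC R := distribution P idm.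

Lemma integral_subfield_law (P : probability O R) (A : set OC) (f : OC -> \bar R) :
  measurable A -> measurable_fun setT f -> (forall w, 0 <= f w) ->
  \int[subfield_law P]_(w in A) f w = \int[P]_(w in A) f w.
Proof.
move=> mA mf f0; rewrite /subfield_law /distribution.
by rewrite (ge0_integral_pushforward (measurable_id_sub Cm) _ mA)//; exact: measurable_funTS.
Qed.

End subfield.

(** * Disintegration and filter densities *)

Section disintegration.
Context {dO dX} {O : measurableType dO} {X : measurableType dX} {R : realType}
  (C : set (set O)) (xi : O -> X).
Hypotheses (Cm : <<s C >> `<=` measurable) (mxi : measurable_fun setT xi).
Local Notation OC := (g_sigma_algebraType C).

Definition conditional_law (P : probability O R) (pi : O -> probability X R) :=
  forall A, measurable A ->
    measurable_wrt (S := \bar R) <<s C >> (fun w => pi w A) /\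
    forall B, <<s C >> B -> P (B `&` xi @^-1` A) = \int[P]_(w in B) pi w A.

Definition graph_stat (w : O) : OC * X := (w, xi w).

Lemma measurable_graph_stat : measurable_fun setT graph_stat.
Proof.
apply/measurable_fun_pairP; split => //=; exact: measurable_id_sub.
Qed.

Section one_law.
Context (P : probability O R) (pi : O -> probability X R).
Hypothesis piP : conditional_law P pi.
Local Notation PC := (subfield_law Cm P).

(** Retyping [pi] on the coarser space turns its measurability with respect to [<<s C >>] into that
    of a kernel. *)
Definition conditional_kernel (w : OC) : {measure set X -> \bar R} := pi w.

Let measurable_conditional_kernel A : measurable A ->
  measurable_fun setT (conditional_kernel ^~ A).
Proof.
by move=> mA _ B mB; rewrite setTI; have [mpi _] := piP mA; exact: mpi.
Qed.

HB.instance Definition _ := isKernel.Build _ _ _ _ _ conditional_kernel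
  measurable_conditional_kernel.

HB.instance Definition _ := Kernel_isProbability.Build _ _ _ _ _ conditional_kernel
  (fun w => probability_setT (pi w)).

Lemma measurable_integral_conditional (F : OC * X -> \bar R) :
  measurable_fun setT F -> (forall z, 0 <= F z) ->
  measurable_fun setT (fun w : OC => \int[pi w]_x F (w, x)).
Proof.
move=> mF F0.
exact: (measurable_fun_integral_sfinite_kernel F conditional_kernel F0 mF).
Qed.

(** On rectangles this is the defining property of a conditional law, and rectangles determine both
    sides. *)
Lemma disintegration (F : OC * X -> \bar R) :
  measurable_fun setT F -> (forall z, 0 <= F z) ->
  \int[P]_w F (w, xi w) = \int[PC]_w \int[pi w]_x F (w, x).
Proof.
move=> mF F0.
have P1 := @positive_functional_weight _ _ O (OC * X)%type R P graph_stat (cst 1)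
  measurable_graph_stat (@measurable_cst _ _ _ _ _ _) (fun=> lee01) (fun=> isT).
have P2 := positive_functional_kernel PC conditional_kernel.
transitivity (\int[P]_w (F (graph_stat w) * cst 1 w)).
  by apply: eq_integral => w _; rewrite mule1.
pose D := [set A `*` B | A in (measurable : set (set OC)) & B in (measurable : set (set X))].
apply: (eq_positive_functional (C := D) P1 P2 _ _ _ _ _ mF F0).
- exact: measurable_prod_measurableType.
- move=> _ _ [A mA [B mB <-]] [A' mA' [B' mB' <-]].
  exists (A `&` A'); first exact: measurableI.
  by exists (B `&` B'); [exact: measurableI|rewrite setXI].
- by exists setT => //; exists setT => //; rewrite setXTT.
- by under eq_integral do rewrite mul1e; rewrite integral_cst// mul1e ltey_eq fin_num_measure.
- move=> _ [A mA [B mB <-]].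
  have [_ /(_ A mA) E] := piP mB.
  have mA' : measurable (A : set O) by exact: Cm.
  transitivity (P ((A : set O) `&` xi @^-1` B)).
    under eq_integral do rewrite mule1.
    have mAB : measurable ((A : set O) `&` xi @^-1` B).
      by apply: measurableI => //; exact: measurable_preimageT.
    transitivity (\int[P]_w (\1_((A : set O) `&` xi @^-1` B) w)%:E); last first.
      by rewrite integral_indic// setIT.
    by apply: eq_integral => w _; congr (_%:E).
  rewrite E -integral_subfield_law//; last exact: measurable_conditional_kernel.
  rewrite [LHS]integral_mkcond; apply: eq_integral => w _; rewrite patchE.
  case: ifPn => wA.
    rewrite (eq_integral (fun x => (\1_B x)%:E)); last first.
      move=> x _; rewrite !indicE; congr (_%:R%:E); congr nat_of_bool.
      apply/idP/idP => [/set_mem[_ Bx]|/set_mem Bx]; apply/mem_set => //.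
      by split => //=; exact: set_mem.
    by rewrite integral_indic// setIT.
  rewrite integral0_eq// => x _; rewrite indicE memNset// => -[/= Aw _].
  by move: wA; rewrite notin_setE.
Qed.
End one_law.

End disintegration.

Lemma standard_borel_pi_systemT {R : realType} {d} {X : measurableType d} :
  standard_borel R X -> exists A : nat -> set X,
    [/\ setI_closed (range A), A 0%N = setT & measurable = <<s range A>>].
Proof.
move=> /standard_borel_pi_system[A [AI mA]].
pose B n := if n is k.+1 then A k else setT; exists B; split => //.
  move=> _ _ [[|i] _ <-] [[|j] _ <-] /=.
  - by exists 0%N => //; rewrite setIT.
  - by exists j.+1 => //; rewrite setTI.
  - by exists i.+1 => //; rewrite setIT.
  - have [k _ kE] := AI _ _ (imageT A i) (imageT A j).
    by exists k.+1.
apply/seteqP; split.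
  rewrite mA; apply: sub_sigma_algebra2 => _ [n _ <-]; by exists n.+1.
apply: smallest_sub; first exact: sigma_algebra_measurable.
move=> _ [[|n] _ <-] //=; rewrite mA; apply: sub_sigma_algebra; by exists n.
Qed.

Section fiber.
Context {dO dX} {O : measurableType dO} {X : measurableType dX} {R : realType}
  (C : set (set O)) (xi : O -> X).
Hypotheses (Cm : <<s C >> `<=` measurable) (mxi : measurable_fun setT xi).
Local Notation OC := (g_sigma_algebraType C).
Context (P Q : probability O R) (piP piQ : O -> probability X R).
Hypotheses (HP : conditional_law C xi P piP) (HQ : conditional_law C xi Q piQ).
Context (m : OC * X -> R) (l : O -> R).
Hypotheses (mm : measurable_fun setT m) (m0 : forall z, (0 <= m z)%R)
  (mE : forall A, measurable A -> P (graph_stat C xi @^-1` A) =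
     \int[Q]_(w in graph_stat C xi @^-1` A) (m (graph_stat C xi w))%:E)
  (lE : density_on <<s C >> P Q l).
Local Notation QC := (subfield_law Cm Q).

Let l0 w : (0 <= l w)%R. Proof. by case: lE. Qed.

Let ml : measurable_fun setT (l : OC -> R).
Proof. by case: lE => ml _ _ _ B mB; rewrite setTI; exact: ml. Qed.

Let mpi A : measurable A -> measurable_fun setT (fun w : OC => piP w A).
Proof. by move=> mA _ B mB; rewrite setTI; have [h _] := HP mA; exact: h. Qed.

Let mpil A : measurable A -> measurable_fun setT (fun w : OC => piP w A * (l w)%:E).
Proof. by move=> mA; apply: emeasurable_funM; [exact: mpi|exact/measurable_EFinP]. Qed.

Let weight1 (E : set OC) A : measurable E -> measurable A ->
  \int[QC]_(w in E) (piP w A * (l w)%:E) = P ((E : set O) `&` xi @^-1` A).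
Proof.
move=> mEE mA; rewrite integral_subfield_law//; last 2 first.
- exact: mpil.
- by move=> w; rewrite mule_ge0 ?lee_fin.
have mEO : measurable (E : set O) by exact: Cm.
have sC : sigma_algebra setT <<s C >> by exact: smallest_sigma_algebra.
have [hA ->//] := HP mA.
rewrite integral_indic_weight//.
under eq_integral do rewrite muleA.
rewrite -(density_integral sC Cm lE).
- by rewrite -integral_indic_weight.
- exact: measurable_wrt_indicM.
- by move=> w; rewrite mule_ge0 ?lee_fin.
Qed.

Let mEm : measurable_fun setT (EFin \o m). Proof. exact/measurable_EFinP. Qed.

Let m_fiber w : measurable_fun setT (fun x => m (w, x)).
Proof. by apply: measurableT_comp mm _; exact: measurable_pair1. Qed.

Let integrand (E : set OC) (A : set X) (z : OC * X) := (\1_(E `*` A) z)%:E * (m z)%:E.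

Let m_integrand (E : set OC) A : measurable E -> measurable A ->
  measurable_fun setT (integrand E A).
Proof.
move=> mEE mA; apply: emeasurable_funM => //; apply/measurable_EFinP.
by apply: measurable_indic; exact: measurableX.
Qed.

Let integrand_ge0 E A z : 0 <= integrand E A z.
Proof. by rewrite mule_ge0 ?lee_fin. Qed.

Let weight2 (E : set OC) A : measurable E -> measurable A ->
  \int[QC]_(w in E) (\int[piQ w]_(x in A) (m (w, x))%:E) = P ((E : set O) `&` xi @^-1` A).
Proof.
move=> mEE mA.
have mEA : measurable (E `*` A) by exact: measurableX.
transitivity (P (graph_stat C xi @^-1` (E `*` A))); last first.
  by congr (P _).
rewrite mE// [RHS]integral_indic_weight; last first.
  exact: measurable_preimageT (measurable_graph_stat Cm mxi) mEA.
rewrite -[RHS]/(\int[Q]_w (integrand E A (w, xi w))).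
rewrite (disintegration Cm mxi HQ (m_integrand mEE mA) (integrand_ge0 E A)).
rewrite [LHS]integral_mkcond; apply: eq_integral => w _; rewrite patchE.
case: ifPn => wE.
  rewrite [LHS]integral_mkcond; apply: eq_integral => x _; rewrite patchE /integrand indicE.
  case: ifPn => xA.
    by rewrite mem_set ?mul1e//; split; exact: set_mem.
  rewrite memNset ?mul0e// => -[_ /=]; by move: xA; rewrite notin_setE.
rewrite integral0_eq// => x _; rewrite /integrand indicE memNset ?mul0e// => -[/=].
by move: wE; rewrite notin_setE.
Qed.

(** Bayes' formula. Over any [E] both sides integrate to the [P]-probability of [E] together with
    [xi] in [A]: the left through the filter of [P] and the change of law [l], the right through the
    joint density [m] and the filter of [Q]. *)
Let fiber_ae A : measurable A ->
  ae_eq QC setT (fun w => piP w A * (l w)%:E)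
    (fun w => \int[piQ w]_(x in A) (m (w, x))%:E).
Proof.
move=> mA; apply: integral_ae_eq => //.
- apply/integrableP; split; first exact: mpil.
  under eq_integral do rewrite gee0_abs ?mule_ge0 ?lee_fin//.
  by rewrite weight1// ltey_eq fin_num_measure// setTI; exact: measurable_preimageT.
- under eq_fun do rewrite integral_mkcond.
  rewrite (_ : (fun w => _) = fun w => \int[piQ w]_x (integrand setT A (w, x))).
    by apply: (measurable_integral_conditional HQ); [exact: m_integrand|exact: integrand_ge0].
  apply/funext => w; apply: eq_integral => x _; rewrite patchE /integrand indicE.
  case: ifPn => xA.
    by rewrite mem_set ?mul1e//; split => //; exact: set_mem.
  rewrite memNset ?mul0e// => -[_ /=]; by move: xA; rewrite notin_setE.
- by move=> E _ mEE; rewrite weight1// weight2.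
Qed.

Lemma density_pos_ae : {ae P, forall w, (0 < l w)%R}.
Proof.
have [_ _ lP] := lE.
have CN : <<s C >> [set w | l w = 0%R].
  have := ml measurableT (measurable_set1 0%R); rewrite setTI.
  by congr (<<s C >> _).
exists [set w | l w = 0%R]; split; first exact: Cm.
- by rewrite lP// integral0_eq// => w /= ->.
- by move=> w /= /negP; rewrite lt0r l0 andbT negbK => /eqP.
Qed.

(** [fiber_ae] has an exceptional set for each event; a countable generating family leaves a single
    one. Division by [l w] is harmless because [l] is positive [P]-almost surely. *)
Lemma fiber_density : standard_borel R X ->
  {ae P, forall w, (0 < l w)%R /\
    density_on measurable (piP w) (piQ w) (fun x => (m (w, x) / l w)%R)}.
Proof.
move=> /standard_borel_pi_systemT[A [AI A0 gA]].
have mA n : measurable (A n) by rewrite gA; apply: sub_sigma_algebra; exists n.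
have aeQ : {ae QC, forall w, forall n, piP w (A n) * (l w)%:E =
    \int[piQ w]_(x in A n) (m (w, x))%:E}.
  by apply/ae_foralln => n; have := fiber_ae (mA n); apply: filterS => w; exact.
(* The exceptional set is [Q]-null and lies in [<<s C >>], where [P] has density [l], so it is
   [P]-null too. *)
have aeP : {ae P, forall w, forall n, piP w (A n) * (l w)%:E =
    \int[piQ w]_(x in A n) (m (w, x))%:E}.
  have [N [mN N0 sN]] := aeQ.
  exists N; split => //; first exact: Cm.
  have [_ _ ->//] := lE.
  have : \int[Q]_(w in N) (l w)%:E = \int[QC]_(w in N) (l w)%:E.
    by rewrite integral_subfield_law//; exact/measurable_EFinP.
  move=> ->; apply: null_set_integral => //.
  by apply/measurable_EFinP; exact: measurable_funTS.
apply: filterS2 density_pos_ae aeP => w lw H; split => //.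
rewrite gA; apply: density_on_generated => //.
- by rewrite gA; exact: sub_sigma_algebra.
- by exists 0%N.
- rewrite -gA => B mB; rewrite -[X in measurable X]setTI.
  apply: (measurable_funM (m_fiber w) (@measurable_cst _ _ _ _ _ _)) => //.
- by move=> x; exact: divr_ge0 (m0 _) (ltW lw).
- move=> _ [n _ <-].
  under eq_integral do rewrite EFinM.
  rewrite ge0_integralZr//; last 3 first.
  + by apply/measurable_EFinP; exact: measurable_funTS (m_fiber w).
  + by move=> x _; rewrite lee_fin.
  + by rewrite lee_fin invr_ge0 ltW.
  rewrite -H -muleA -EFinM divff ?mule1// gt_eqF//.
Qed.

End fiber.

(** * Relative entropy and total variation *)

Section entropy_function.
Context {R : realType}.
Implicit Types r s e : R.
Local Open Scope ring_scope.

Definition entropy_fun r : R := r * ln r - r + 1.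

Lemma ln_le_subr1 r : 0 < r -> ln r <= r - 1.
Proof.
by move=> r0; have := expR_ge1Dx (ln r); rewrite lnK ?posrE//; lra.
Qed.

Lemma mulr_ln_ge r : 0 <= r -> r - 1 <= r * ln r.
Proof.
rewrite le_eqVlt => /predU1P[<-|r0]; first by rewrite mul0r; lra.
have := ln_le_subr1 (_ : 0 < r^-1); rewrite invr_gt0 lnV ?posrE// => /(_ r0) h.
have := ler_wpM2l (ltW r0) h; rewrite mulrBr divff ?gt_eqF//; lra.
Qed.

(** With [s = Num.sqrt r] one has [r * ln r = 2 * s * (s * ln s)], which is at least
    [2 * s * (s - 1)]; subtracting [s ^+ 2] and adding [1] leaves the square of [s - 1]. *)
Lemma entropy_fun_ge_hellinger r : 0 <= r -> (Num.sqrt r - 1) ^+ 2 <= entropy_fun r.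
Proof.
move=> r0; rewrite /entropy_fun; have s0 := sqrtr_ge0 r.
rewrite -[in X in _ <= X](sqr_sqrtr r0); set s := Num.sqrt r in s0 *.
have [->|sn0] := eqVneq s 0; first by rewrite expr0n/= mul0r; lra.
have sp : 0 < s by rewrite lt0r sn0.
have := ler_wpM2l s0 (mulr_ln_ge s0).
rewrite lnXn// !expr2 mulr2n; lra.
Qed.

Lemma entropy_fun_ge0 r : 0 <= r -> 0 <= entropy_fun r.
Proof. by move=> /entropy_fun_ge_hellinger; apply: le_trans; exact: sqr_ge0. Qed.

(** A pointwise form of Pinsker's inequality, linear in the entropy so that it can be integrated.
    Factor [r - 1] through [s = Num.sqrt r], apply the arithmetic-geometric inequality with
    parameter [e] to [|s - 1|] and [s + 1], and bound [(s + 1) ^+ 2] by [2 * (s ^+ 2 + 1)]. *)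
Lemma norm_subr1_le_entropy e r : 0 < e -> 0 <= r ->
  `|r - 1| <= e * (r + 1) + (2 * e)^-1 * entropy_fun r.
Proof.
move=> e0 r0; have s0 := sqrtr_ge0 r.
have h := entropy_fun_ge_hellinger r0.
have e20 : 0 < (2 * e)^-1 by rewrite invr_gt0 mulr_gt0.
apply: le_trans (_ : e * (r + 1) + (2 * e)^-1 * (Num.sqrt r - 1) ^+ 2 <= _); last first.
  by rewrite lerD2l ler_pM2l.
rewrite -[in X in X <= _](sqr_sqrtr r0) -[in X in e * (X + 1)](sqr_sqrtr r0).
set s := Num.sqrt r in s0 *.
have -> : s ^+ 2 - 1 = (s - 1) * (s + 1) by rewrite expr2; ring.
rewrite normrM (ger0_norm (_ : 0 <= s + 1)); last by lra.
set a := `|s - 1|; have -> : (s - 1) ^+ 2 = a ^+ 2 by rewrite /a real_normK// num_real.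
have sq : 0 <= (2 * e)^-1 * (a - e * (s + 1)) ^+ 2.
  by rewrite mulr_ge0 ?sqr_ge0// ltW.
have E : (2 * e)^-1 * (a - e * (s + 1)) ^+ 2 =
   (2 * e)^-1 * a ^+ 2 - a * (s + 1) + e * (s + 1) ^+ 2 / 2.
  by field; rewrite gt_eqF.
have h2 : (s + 1) ^+ 2 / 2 <= s ^+ 2 + 1.
  have := sqr_ge0 (s - 1); rewrite !expr2; lra.
have := ler_wpM2l (ltW e0) h2; rewrite mulrA; lra.
Qed.

Definition lnp r : R := Num.max (ln r) 0.
Definition lnm r : R := Num.max (- ln r) 0.

Lemma lnp_ge0 r : 0 <= lnp r. Proof. by rewrite /lnp le_max lexx orbT. Qed.
Lemma lnm_ge0 r : 0 <= lnm r. Proof. by rewrite /lnm le_max lexx orbT. Qed.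

(** Arranged so that for [r >= 0] every term is nonnegative: the identity can then be integrated in
    the extended reals even when the entropy is infinite. *)
Lemma entropy_fun_lnpm r : entropy_fun r + r * lnm r + r = r * lnp r + 1.
Proof.
rewrite /entropy_fun /lnm /lnp.
have [l0|l0] := leP (ln r) 0.
  by rewrite max_l; [ring|lra].
by rewrite max_r; [ring|lra].
Qed.

Lemma mulr_lnm_le1 r : 0 <= r -> r * lnm r <= 1.
Proof.
move=> r0; rewrite /lnm; have := mulr_ln_ge r0.
by case: (leP (- ln r) 0) => _; rewrite ?mulr0 ?mulrN; lra.
Qed.

Lemma entropy_fun_le_lnp r : 0 <= r -> entropy_fun r + r <= r * lnp r + 1.
Proof.
by move=> r0; rewrite -entropy_fun_lnpm lerD2r lerDl mulr_ge0// lnm_ge0.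
Qed.

Lemma lnp_le_entropy_fun r : 0 <= r -> r * lnp r <= entropy_fun r + r.
Proof.
move=> r0; have := entropy_fun_lnpm r; have := mulr_lnm_le1 r0; lra.
Qed.

Lemma mulr_lnp_truncated K r : 0 <= r -> r <= K -> r * lnp r <= K * `|r - 1|.
Proof.
move=> r0 rK; have [r1|r1] := leP r 1.
  rewrite /lnp max_r; last exact: ln_le0.
  by rewrite mulr0 mulr_ge0//; exact: le_trans rK.
have l : lnp r <= `|r - 1|.
  rewrite /lnp max_l; last by apply: ln_ge0; exact: ltW.
  by apply: le_trans (ler_norm _); apply: ln_le_subr1; lra.
by apply: ler_pM => //; exact: lnp_ge0.
Qed.

(** With [x = ln a] and [y = - ln b], the hypothesis reads [x + y > 4 * c], which is exactly what
    makes [x + y] at most [2 * ((x - c) + (y - c))]. This is the origin of both the [4] and the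
    [2]. *)
Lemma ln_tail_split (c a b : R) : 0 < c -> 0 < a -> 0 < b -> expR (4 * c) < a / b ->
  ln (a / b) <= 2 * (Num.max (ln a - c) 0 + Num.max (ln b^-1 - c) 0).
Proof.
move=> c0 a0 b0; rewrite -ltr_ln ?posrE ?expR_gt0 ?divr_gt0// expRK.
rewrite lnM ?posrE ?invr_gt0//.
set x := ln a; set y := ln b^-1 => h.
have h1 : x - c <= Num.max (x - c) 0 by rewrite le_max lexx.
have h2 : y - c <= Num.max (y - c) 0 by rewrite le_max lexx.
lra.
Qed.

(** [ln r - c] is the logarithm of [expR (- c) * r], and a logarithm is below its argument. *)
Lemma ln_tail_le (c r : R) : 0 < r -> Num.max (ln r - c) 0 <= expR (- c) * r.
Proof.
move=> r0; rewrite ge_max; apply/andP; split; last first.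
  by rewrite mulr_ge0 ?expR_ge0// ltW.
have := ln_sublinear (mulr_gt0 (expR_gt0 (- c)) r0).
rewrite lnM ?posrE ?expR_gt0// expRK; lra.
Qed.

Lemma measurable_entropy_fun : measurable_fun setT entropy_fun.
Proof.
apply: measurable_funD => //; apply: measurable_funB => //.
by apply: measurable_funM => //; exact: measurable_ln.
Qed.

Lemma measurable_lnp : measurable_fun setT lnp.
Proof. by apply: measurable_maxr => //; exact: measurable_ln. Qed.

Lemma measurable_lnm : measurable_fun setT lnm.
Proof.
by apply: measurable_maxr => //; apply: measurableT_comp => //; exact: measurable_ln.
Qed.

End entropy_function.

Section real_valued.
Context {d} {X : measurableType d} {R : realType} (q : {measure set X -> \bar R}).
Implicit Types f g : X -> R.

Lemma integralD_ge0_EFin f g : measurable_fun setT f -> (forall x, 0 <= f x)%R ->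
  measurable_fun setT g -> (forall x, 0 <= g x)%R ->
  \int[q]_x (f x + g x)%:E = \int[q]_x (f x)%:E + \int[q]_x (g x)%:E.
Proof.
move=> mf f0 mg g0; under eq_integral do rewrite EFinD.
apply: ge0_integralD => //.
- by move=> x _; rewrite lee_fin.
- exact/measurable_EFinP.
- by move=> x _; rewrite lee_fin.
- exact/measurable_EFinP.
Qed.

Lemma ge0_le_integral_EFin f g : measurable_fun setT f -> (forall x, 0 <= f x)%R ->
  measurable_fun setT g -> (forall x, f x <= g x)%R ->
  \int[q]_x (f x)%:E <= \int[q]_x (g x)%:E.
Proof.
move=> mf f0 mg fg; apply: ge0_le_integral => //.
- by move=> x _; rewrite lee_fin.
- exact/measurable_EFinP.
- exact/measurable_EFinP.
- by move=> x _; rewrite lee_fin.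
Qed.
End real_valued.

Lemma integral_cst1 {d} {X : measurableType d} {R : realType} (r : probability X R) :
  \int[r]_x 1 = 1.
Proof. by rewrite integral_cst// mul1e; exact: probability_setT. Qed.

Section fixed_laws.
Context {d} {X : measurableType d} {R : realType} (p q : probability X R).
Implicit Types f : X -> R.

Lemma density_measurable f : density_on measurable p q f -> measurable_fun setT f.
Proof. by case=> mf _ _ _ B mB; rewrite setTI; exact: mf. Qed.

Lemma density_integralT f (g : X -> \bar R) : density_on measurable p q f ->
  measurable_fun setT g -> (forall x, 0 <= g x) ->
  \int[p]_x g x = \int[q]_x (g x * (f x)%:E).
Proof.
move=> df mg g0; apply: (density_integral (G := measurable)) => //.
- exact: sigma_algebra_measurable.
- by move=> B mB; exact: measurable_preimageT.
Qed.

Lemma density_integral1 f : density_on measurable p q f -> \int[q]_x (f x)%:E = 1.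
Proof. by move=> [_ _ fE]; rewrite -fE//; exact: probability_setT. Qed.

Lemma density_ae_eq f g : density_on measurable p q f -> density_on measurable p q g ->
  ae_eq q setT (EFin \o f) (EFin \o g).
Proof.
move=> df dg; have [_ f0 fE] := df; have [_ g0 gE] := dg.
have mf := density_measurable df; have mg := density_measurable dg.
apply: integral_ae_eq => //.
- apply/integrableP; split; first exact/measurable_EFinP.
  under eq_integral do rewrite gee0_abs ?lee_fin//.
  by rewrite (density_integral1 df) ltry.
- exact/measurable_EFinP.
- by move=> E _ mE /=; rewrite -fE// -gE.
Qed.

(** Densities are unique up to [q]-null sets, so the one chosen in [rel_entropy] may be replaced by
    [f]. The terms [- r + 1] of [entropy_fun] have [q]-mean zero and make the integrand nonnegative.
    The negative part of the logarithm has [p]-mean at most [1], so the difference of the two parts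
    is meaningful. *)
Lemma rel_entropyE f : density_on measurable p q f ->
  rel_entropy p q = \int[q]_x (entropy_fun (f x))%:E.
Proof.
move=> df; rewrite /rel_entropy /rel_entropy_on.
case: pselect => [ex|[]]; last by exists f.
set g := projT1 (cid ex).
have dg : density_on measurable p q g := projT2 (cid ex).
have [_ f0 _] := df; have [_ g0 _] := dg.
have mf := density_measurable df; have mg := density_measurable dg.
have mphi h : measurable_fun setT h -> measurable_fun setT (fun x : X => (entropy_fun (h x : R))%:E).
  by move=> mh; apply/measurable_EFinP; exact: measurableT_comp (@measurable_entropy_fun R) mh.
transitivity (\int[q]_x (entropy_fun (g x))%:E); last first.
  apply: ge0_ae_eq_integral => //; [exact: mphi|exact: mphi| | |].
  - by move=> x _; rewrite lee_fin entropy_fun_ge0.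
  - by move=> x _; rewrite lee_fin entropy_fun_ge0.
  - by apply: filterS (density_ae_eq dg df) => x /= /(_ Logic.I) [->].
have mp : measurable_fun setT (fun x => lnp (g x)).
  exact: measurableT_comp (@measurable_lnp R) mg.
have mm : measurable_fun setT (fun x => lnm (g x)).
  exact: measurableT_comp (@measurable_lnm R) mg.
rewrite integralE.
rewrite (eq_integral (fun x => (lnp (g x))%:E)); last first.
  by move=> x _; rewrite funeposE /lnp EFin_max.
rewrite [X in _ - X](eq_integral (fun x => (lnm (g x))%:E)); last first.
  by move=> x _; rewrite funenegE /lnm EFin_max.
rewrite !(density_integralT dg); last 4 first.
- by apply/measurable_EFinP.
- by move=> x; rewrite lee_fin lnm_ge0.
- by apply/measurable_EFinP.
- by move=> x; rewrite lee_fin lnp_ge0.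
set a := \int[q]_x _; set b := \int[q]_x _; set c := \int[q]_x _.
have mgp : measurable_fun setT (fun x => g x * lnp (g x))%R by exact: measurable_funM.
have mgm : measurable_fun setT (fun x => g x * lnm (g x))%R by exact: measurable_funM.
have gp0 x : (0 <= g x * lnp (g x))%R by rewrite mulr_ge0// lnp_ge0.
have gm0 x : (0 <= g x * lnm (g x))%R by rewrite mulr_ge0// lnm_ge0.
have aE : a = \int[q]_x (g x * lnp (g x))%:E.
  by apply: eq_integral => x _; rewrite muleC EFinM.
have bE : b = \int[q]_x (g x * lnm (g x))%:E.
  by apply: eq_integral => x _; rewrite muleC EFinM.
have b1 : b <= 1.
  rewrite -(integral_cst1 q) bE.
  by apply: ge0_le_integral_EFin => // x; exact: mulr_lnm_le1.
have b0 : 0 <= b by rewrite bE; apply: integral_ge0 => x _; rewrite lee_fin.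
have bfin : b \is a fin_num.
  by rewrite ge0_fin_numE//; apply: le_lt_trans b1 _; rewrite ltry.
have mphiR : measurable_fun setT (fun x => entropy_fun (g x)).
  exact: measurableT_comp (@measurable_entropy_fun R) mg.
have phi0 x : (0 <= entropy_fun (g x))%R by exact: entropy_fun_ge0.
have E : c + b + 1 = a + 1.
  rewrite -{1}(density_integral1 dg) /c bE -integralD_ge0_EFin//.
  rewrite -integralD_ge0_EFin//; last 2 first.
  - exact: measurable_funD.
  - by move=> x; rewrite addr_ge0.
  under eq_integral do rewrite entropy_fun_lnpm.
  by rewrite integralD_ge0_EFin// -aE integral_cst1.
(* Only [1] and [b], both finite, are cancelled; [a] and [c] may be infinite. *)
have := congr1 (fun z => z - 1) E.
by rewrite !addeK// => <-; rewrite addeK.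
Qed.

Lemma rel_entropy_ge0 : 0 <= rel_entropy p q.
Proof.
have [[f df]|nf] := pselect (exists f, density_on measurable p q f).
  rewrite (rel_entropyE df); apply: integral_ge0 => x _.
  by rewrite lee_fin entropy_fun_ge0//; case: df.
by rewrite /rel_entropy /rel_entropy_on; case: pselect.
Qed.

Lemma tv_dist_ge0 : 0 <= tv_dist p q.
Proof.
apply: le_ereal_sup_tmp; exists `|(\int[p]_x (cst 0%R x)%:E - \int[q]_x (cst 0%R x)%:E)%E|%E => //.
exists (cst 0%R) => //; split => // x; by rewrite normr0.
Qed.

Lemma tv_distE f : density_on measurable p q f ->
  tv_dist p q = \int[q]_x `|f x - 1|%:E.
Proof.
move=> df; have [_ f0 _] := df; have mf := density_measurable df.
have mabs : measurable_fun setT (fun x => `|f x - 1|%R).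
  by apply: measurableT_comp => //; exact: measurable_funB.
set t := \int[q]_x _.
have t0 : 0 <= t by apply: integral_ge0 => x _; rewrite lee_fin.
have tfin : t \is a fin_num.
  rewrite ge0_fin_numE//; apply: (@le_lt_trans _ _ 2); last by rewrite ltry.
  rewrite (_ : 2 = \int[q]_x (f x + 1)%:E); last first.
    by rewrite integralD_ge0_EFin// density_integral1// integral_cst1 -EFinD.
  apply: ge0_le_integral_EFin => //; first exact: measurable_funD.
  by move=> x; rewrite (le_trans (ler_normB _ _))// normr1 ger0_norm.
(* Test functions are shifted to [h + 1], which is nonnegative, so that the comparisons below need
   only monotonicity and additivity of nonnegative integrals. *)
have key (h : X -> R) : measurable_fun setT h -> (forall x, `|h x| <= 1)%R ->
  exists a b : R, [/\ \int[p]_x (h x)%:E = a%:E, \int[q]_x (h x)%:E = b%:E,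
    \int[q]_x ((h x + 1) * f x)%:E = (a + 1)%:E & \int[q]_x (h x + 1)%:E = (b + 1)%:E].
  move=> mh h1.
  have ih (r : probability X R) : r.-integrable setT (EFin \o h).
    apply: measurable_bounded_integrable => //.
      by rewrite ltey_eq fin_num_measure.
    by exists 1%R; split => // M M1 z _ /=; exact: le_trans (h1 z) (ltW M1).
  have fin (r : probability X R) : \int[r]_x (h x)%:E \is a fin_num.
    exact: integrable_fin_num (ih r).
  have h1_0 z : (0 <= h z + 1)%R by have := h1 z; rewrite ler_norml => /andP[]; lra.
  have E1 (r : probability X R) : \int[r]_x (h x + 1)%:E = \int[r]_x (h x)%:E + 1.
    under eq_integral do rewrite EFinD.
    rewrite integralD//; last 2 first.
    - exact: (ih r).
    - exact: finite_measure_integrable_cst.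
    by rewrite integral_cst1.
  exists (fine (\int[p]_x (h x)%:E)), (fine (\int[q]_x (h x)%:E)).
  rewrite !fineK// !EFinD !fineK//; split => //.
  rewrite -E1 (density_integralT df)//.
    by apply/measurable_EFinP; exact: measurable_funD.
have mu1 (h : X -> R) : measurable_fun setT h -> measurable_fun setT (fun x => (h x + 1) * f x)%R.
  by move=> mh; apply: measurable_funM => //; exact: measurable_funD.
have mh1 (h : X -> R) : measurable_fun setT h -> measurable_fun setT (fun x => h x + 1)%R.
  by move=> mh; exact: measurable_funD.
have h1_0 (h : X -> R) z : (`|h z| <= 1)%R -> (0 <= h z + 1)%R.
  by rewrite ler_norml => /andP[]; lra.
have tE : t = (fine t)%:E by exact: esym (fineK tfin).
have I1 (h : X -> R) : measurable_fun setT h -> (forall x, `|h x| <= 1)%R ->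
    \int[q]_x ((h x + 1) * f x)%:E + 1 = \int[q]_x ((h x + 1) * f x + 1)%:E.
  move=> mh h1; rewrite integralD_ge0_EFin ?integral_cst1//; first exact: mu1.
  by move=> x; rewrite mulr_ge0// h1_0.
have I2 (h : X -> R) : measurable_fun setT h -> (forall x, `|h x| <= 1)%R ->
    \int[q]_x (h x + 1)%:E + t + 1 = \int[q]_x (h x + 1 + `|f x - 1| + f x)%:E.
  move=> mh h1; have h0 x := h1_0 h x (h1 x).
  rewrite [RHS]integralD_ge0_EFin//; last 2 first.
  - by apply: measurable_funD => //; exact: mh1.
  - by move=> x; rewrite addr_ge0.
  by rewrite [X in _ = X + _]integralD_ge0_EFin ?(density_integral1 df)//; exact: mh1.
have I3 (h : X -> R) : measurable_fun setT h -> (forall x, `|h x| <= 1)%R ->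
    \int[q]_x (h x + 1)%:E + 1 = \int[q]_x (h x + 1 + f x)%:E.
  move=> mh h1; have h0 x := h1_0 h x (h1 x).
  by rewrite [RHS]integralD_ge0_EFin ?(density_integral1 df)//; exact: mh1.
have I4 (h : X -> R) : measurable_fun setT h -> (forall x, `|h x| <= 1)%R ->
    \int[q]_x ((h x + 1) * f x)%:E + t + 1 =
    \int[q]_x ((h x + 1) * f x + `|f x - 1| + 1)%:E.
  move=> mh h1; have h0 x : (0 <= (h x + 1) * f x)%R by rewrite mulr_ge0// h1_0.
  have mhf := mu1 h mh.
  rewrite integralD_ge0_EFin ?integral_cst1//; last 2 first.
  - exact: measurable_funD.
  - by move=> x; rewrite addr_ge0.
  by rewrite integralD_ge0_EFin.
have abs_le (h y : R) : (`|h| <= 1 -> h * (y - 1) <= `|y - 1|)%R.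
  move=> h1; rewrite (le_trans (ler_norm _))// normrM ler_piMl//.
rewrite /tv_dist; apply/eqP; rewrite eq_le; apply/andP; split.
  apply: ge_ereal_sup => _ [h [mh h1] <-].
  have [a [b [-> -> E1 E2]]] := key h mh h1.
  have L1 : (a + 1 + 1 <= b + 1 + fine t + 1)%R.
    rewrite -lee_fin -[leLHS]/((a + 1)%:E + 1) -[leRHS]/((b + 1)%:E + (fine t)%:E + 1).
    rewrite -E1 I1// -E2 -tE I2//.
    apply: ge0_le_integral_EFin => //.
    - by apply: measurable_funD => //; exact: mu1.
    - by move=> x; rewrite addr_ge0// mulr_ge0// h1_0.
    - by apply: measurable_funD => //; apply: measurable_funD => //; exact: mh1.
    - by move=> x; have := abs_le (h x) (f x) (h1 x); lra.
  have L2 : (b + 1 + 1 <= a + 1 + fine t + 1)%R.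
    rewrite -lee_fin -[leLHS]/((b + 1)%:E + 1) -[leRHS]/((a + 1)%:E + (fine t)%:E + 1).
    rewrite -E2 I3// -E1 -tE I4//.
    apply: ge0_le_integral_EFin => //.
    - by apply: measurable_funD => //; exact: mh1.
    - by move=> x; rewrite addr_ge0// h1_0.
    - by apply: measurable_funD => //; apply: measurable_funD => //; exact: mu1.
    - move=> x; have := abs_le (- h x)%R (f x); rewrite normrN => /(_ (h1 x)); lra.
  by rewrite tE -EFinB abse_EFin lee_fin ler_norml; apply/andP; split; lra.
(* The sign of [f - 1], with value [1] where [f] equals [1]; the supremum is attained there. *)
pose h x : R := (2 * \1_(f @^-1` `[1%R, +oo[%classic) x - 1)%R.
have mh : measurable_fun setT h.
  apply: measurable_funB => //; apply: measurable_funM => //; apply: measurable_indic.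
  exact: measurable_preimageT mf (measurable_itv _).
have hE x : (1 <= f x /\ h x = 1)%R \/ (f x < 1 /\ h x = -1)%R.
  rewrite /h indicE; have [f1|f1] := leP 1%R (f x).
    by left; split => //; rewrite mem_set /= ?in_itv/= ?f1//; lra.
  right; split => //; rewrite memNset /= ?in_itv/= ?andbT; first lra.
  by apply/negP; rewrite -ltNge.
have h1 x : (`|h x| <= 1)%R.
  by case: (hE x) => -[_ ->]; rewrite ?normrN normr1.
have [a [b [Ea Eb E1 E2]]] := key h mh h1.
apply: (@le_trans _ _ `|(\int[p]_x (h x)%:E - \int[q]_x (h x)%:E)%E|%E); last first.
  by apply: ereal_sup_ubound; exists h.
rewrite Ea Eb tE -EFinB abse_EFin lee_fin (le_trans _ (ler_norm _))//.
suff : (b + 1 + fine t + 1 = a + 1 + 1)%R by lra.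
apply: EFin_inj.
rewrite -[LHS]/((b + 1)%:E + (fine t)%:E + 1) -[RHS]/((a + 1)%:E + 1).
rewrite -E2 -tE I2// -E1 I1//.
apply: eq_integral => x _; congr (_%:E).
case: (hE x) => -[fx ->].
  by rewrite ger0_norm; lra.
by rewrite ltr0_norm; lra.
Qed.

End fixed_laws.

(* No measurability: on nonnegative functions the integral is a supremum over
   simple functions, and these can be cut off outside a null set. *)
Lemma ae_le_integral {d} {O : measurableType d} {R : realType}
    (mu : {measure set O -> \bar R}) (f g : O -> \bar R) :
  (forall w, 0 <= f w) -> (forall w, 0 <= g w) ->
  {ae mu, forall w, f w <= g w} -> \int[mu]_w f w <= \int[mu]_w g w.
Proof.
move=> f0 g0 [N [mN N0 fgN]]; rewrite !ge0_integralTE//.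
apply: ge_ereal_sup => _ [h hf <-].
have mNC := measurableC mN.
apply: ereal_sup_ubound; exists (proj_nnsfun h mNC).
  move=> x; rewrite /= mindicE; case: (boolP (x \in ~` N)) => xN /=.
    rewrite mulr1; apply: le_trans (hf x) _.
    by apply: contrapT => nfg; move: xN => /set_mem; apply; exact: fgN.
  by rewrite mulr0.
rewrite -!integralT_nnsfun; apply: ge0_ae_eq_integral => //.
- exact/measurable_EFinP.
- exact/measurable_EFinP.
- by move=> x _; rewrite lee_fin.
- by move=> x _; rewrite lee_fin.
- exists N; split => // x /= /not_implyP[_]; apply: contra_notP => xN.
  by rewrite /= mindicE mem_set// mulr1.
Qed.

Lemma ae_eq_integral_ge0 {d} {O : measurableType d} {R : realType}
    (mu : {measure set O -> \bar R}) (f g : O -> \bar R) :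
  (forall w, 0 <= f w) -> (forall w, 0 <= g w) ->
  {ae mu, forall w, f w = g w} -> \int[mu]_w f w = \int[mu]_w g w.
Proof.
move=> f0 g0 fg; apply/eqP; rewrite eq_le; apply/andP; split.
  by apply: ae_le_integral => //; apply: filterS fg => w ->.
by apply: ae_le_integral => //; apply: filterS fg => w ->.
Qed.

(** * Limits of extended real sequences and of tails *)

Lemma cvge0_dominated {R : realType} (u v : nat -> \bar R) (n0 : nat) :
  (forall n, 0 <= u n) -> (forall n, 0 <= v n) ->
  (forall e : R, (0 < e)%R -> exists2 K : R, (0 <= K)%R &
    forall n, (n0 <= n)%N -> u n <= K%:E * v n + e%:E) ->
  v @ \oo --> 0 -> u @ \oo --> 0.
Proof.
move=> u0 v0 H /fine_cvgP[vfin v_0].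
have lim e : (0 < e)%R -> \forall n \near \oo, u n <= e%:E.
  move=> e0; have [K K0 HK] := H _ (divr_gt0 e0 (ltr0Sn R 1)).
  (* [K] may be zero, so the tolerance for [v] is divided by [K + 1]. *)
  have K1 : (0 < K + 1)%R by rewrite ltr_wpDl.
  have d0 : (0 < e / 2 / (K + 1))%R by rewrite !divr_gt0.
  move/cvgrPdist_le : v_0 => /(_ _ d0) v_0.
  near=> n.
  have vn : v n \is a fin_num by near: n.
  have vd : (`|0 - fine (v n)| <= e / 2 / (K + 1))%R by near: n.
  have n0n : (n0 <= n)%N by near: n; exists n0.
  apply: le_trans (HK n n0n) _.
  rewrite -(fineK vn) -EFinM -EFinD lee_fin.
  have v0' : (0 <= fine (v n))%R by exact: fine_ge0.
  move: vd; rewrite sub0r normrN ger0_norm// ler_pdivlMr// => vd.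
  have : (K * fine (v n) <= fine (v n) * (K + 1))%R by lra.
  lra.
apply/fine_cvgP; split.
  have := lim _ ltr01; apply: filterS => n un.
  by rewrite ge0_fin_numE//; apply: le_lt_trans un _; rewrite ltry.
apply/cvgrPdist_le => e e0; have := lim _ e0; apply: filterS => n un.
have ufin : u n \is a fin_num by rewrite ge0_fin_numE//; apply: le_lt_trans un _; rewrite ltry.
rewrite sub0r normrN ger0_norm; last exact: fine_ge0.
by rewrite -lee_fin fineK.
Unshelve. all: by end_near. Qed.

(** Dominated convergence: at each point the tail vanishes once [k] exceeds [ln (f w)], and
    [lnp (f w)] bounds all tails. *)
Lemma lnp_tail_cvg0 {d} {O : measurableType d} {R : realType}
    (mu : {measure set O -> \bar R}) (f : O -> R) :
  measurable_fun setT f -> \int[mu]_w (lnp (f w))%:E < +oo ->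
  \int[mu]_w (Num.max (ln (f w) - k%:R) 0)%:E @[k --> \oo] --> 0.
Proof.
move=> mf fin.
have mln : measurable_fun setT (fun w => ln (f w)).
  exact: measurableT_comp (@measurable_ln R) mf.
have mk k : measurable_fun setT (fun w => (Num.max (ln (f w) - k%:R) 0)%:E).
  by apply/measurable_EFinP; apply: measurable_maxr => //; exact: measurable_funB.
have mlnp : measurable_fun setT (fun w => (lnp (f w))%:E).
  by apply/measurable_EFinP; exact: measurableT_comp (@measurable_lnp R) mf.
have := @dominated_cvg _ O R mu setT measurableT
  (fun k w => (Num.max (ln (f w) - k%:R) 0)%:E) (cst 0) (fun w => (lnp (f w))%:E) mk.
rewrite integral0; apply.
- move=> w _; apply: cvg_near_cst; near=> k.
  congr EFin; apply: max_r; rewrite subr_le0.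
  have [l0|l0] := leP (ln (f w)) 0%R; first by apply: le_trans l0 _; rewrite ler0n.
  apply: le_trans (ltW (truncnS_gt _)) _; rewrite ler_nat.
  by near: k; exists (Num.trunc (ln (f w))).+1.
- by [].
- apply/integrableP; split => //.
  by under eq_integral do rewrite gee0_abs ?lee_fin ?lnp_ge0//.
- move=> k w _; rewrite gee0_abs ?lee_fin; last by rewrite le_max lexx orbT.
  rewrite /lnp ge_max le_max lerBlDr lerDl ler0n /=.
  by rewrite le_max lexx orbT.
Unshelve. all: by end_near. Qed.

(** By the convention [0^-1 = 0], the inverse of a nonnegative [g] is [expR (- ln g)] where [g] is
    positive and [0] elsewhere, a combination of measurable maps. *)
Lemma measurable_fun_div_ge0 {d} {S : measurableType d} {R : realType} (f g : S -> R) :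
  measurable_fun setT f -> measurable_fun setT g -> (forall x, 0 <= g x)%R ->
  measurable_fun setT (fun x => f x / g x)%R.
Proof.
move=> mf mg g0.
rewrite (_ : (fun x => _) =
    fun x => (f x * (if 0 < g x then expR (- ln (g x)) else 0))%R); last first.
  apply/funext => x; case: ltP => gx; first by rewrite -lnV ?posrE// lnK// posrE invr_gt0.
  by have -> : g x = 0%R by [apply/eqP; rewrite eq_le gx g0]; rewrite invr0.
apply: measurable_funM => //; apply: measurable_fun_ifT => //.
  exact: measurable_fun_ltr.
apply: measurableT_comp => //; apply: measurableT_comp => //.
exact: measurableT_comp (@measurable_ln R) mg.
Qed.

Definition lnp_tail {R : realType} (K r : R) : R := if (K < r)%R then lnp r else 0%R.

Lemma measurable_lnp_tail {R : realType} (K : R) : measurable_fun setT (lnp_tail K).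
Proof.
apply: measurable_fun_ifT => //; last exact: measurable_lnp.
exact: measurable_fun_ltr.
Qed.

(** * Entropy and total variation of the filters at a fixed time *)

Section one_time.
Context {dO dX} {O : measurableType dO} {X : measurableType dX} {R : realType}
  (C : set (set O)) (xi : O -> X).
Hypotheses (Cm : <<s C >> `<=` measurable) (mxi : measurable_fun setT xi)
  (bX : standard_borel R X).
Local Notation OC := (g_sigma_algebraType C).
Context (P Q : probability O R) (piP piQ : O -> probability X R).
Hypotheses (HP : conditional_law C xi P piP) (HQ : conditional_law C xi Q piQ).
Context (m : OC * X -> R) (l : O -> R).
Hypotheses (mm : measurable_fun setT m) (m0 : forall z, (0 <= m z)%R)
  (mE : forall A, measurable A -> P (graph_stat C xi @^-1` A) =
     \int[Q]_(w in graph_stat C xi @^-1` A) (m (graph_stat C xi w))%:E)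
  (lE : density_on <<s C >> P Q l).

Let r (z : OC * X) : R := (m z / l z.1)%R.

Let l0 w : (0 <= l w)%R. Proof. by case: lE. Qed.
Let r0 z : (0 <= r z)%R. Proof. exact: divr_ge0. Qed.

Let ml : measurable_fun setT (l : OC -> R).
Proof. by case: lE => ml _ _ _ B mB; rewrite setTI; exact: ml. Qed.

Let mr : measurable_fun setT r.
Proof.
apply: measurable_fun_div_ge0 => //.
exact: (measurableT_comp ml measurable_fst).
Qed.

Let fdens := fiber_density Cm mxi HP HQ mm m0 mE lE bX.

Let measurable_fiber (g : R -> R) : measurable_fun setT g ->
  measurable_fun setT (fun z : OC * X => (g (r z))%:E).
Proof. by move=> mg; apply/measurable_EFinP; exact: measurableT_comp mg mr. Qed.

Let m_ent := measurable_fiber (@measurable_entropy_fun R).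
Let m_abs : measurable_fun setT (fun z : OC * X => `|r z - 1|%:E).
Proof.
apply: (measurable_fiber (g := fun s => `|s - 1|%R)).
by apply: measurableT_comp => //; exact: measurable_funB.
Qed.

Let entropy_fiber w := \int[piQ w]_x (entropy_fun (r (w, x)))%:E.
Let tv_fiber w := \int[piQ w]_x `|r (w, x) - 1|%:E.

Let entropy_fiber_ge0 w : 0 <= entropy_fiber w.
Proof. by apply: integral_ge0 => x _; rewrite lee_fin entropy_fun_ge0. Qed.

Let tv_fiber_ge0 w : 0 <= tv_fiber w.
Proof. by apply: integral_ge0 => x _; rewrite lee_fin. Qed.

Let integral_subfield (f : OC -> \bar R) : measurable_fun setT f -> (forall w, 0 <= f w) ->
  \int[subfield_law Cm P]_w f w = \int[P]_w f w.
Proof. by move=> mf f0; exact: integral_subfield_law. Qed.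

Let from_OC (f : OC -> \bar R) : measurable_fun setT f -> measurable_fun setT (f : O -> \bar R).
Proof. by move=> mf; exact: measurableT_comp mf (measurable_id_sub Cm). Qed.

Let m_entropy_fiber : measurable_fun setT (entropy_fiber : O -> \bar R).
Proof.
apply: from_OC; apply: (measurable_integral_conditional HQ m_ent).
by move=> z; rewrite lee_fin entropy_fun_ge0.
Qed.

Let m_tv_fiber : measurable_fun setT (tv_fiber : O -> \bar R).
Proof.
apply: from_OC; apply: (measurable_integral_conditional HQ m_abs).
by move=> z; rewrite lee_fin.
Qed.

(** [rel_entropy] chooses a density separately for each [w], which gives no control of measurability
    in [w]. The fiber integral is measurable and agrees with it almost surely. *)
Let entropyE : \int[P]_w rel_entropy (piP w) (piQ w) = \int[P]_w entropy_fiber w.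
Proof.
apply: ae_eq_integral_ge0 => //; first by move=> w; exact: rel_entropy_ge0.
by apply: filterS fdens => w [_ dw]; rewrite (rel_entropyE dw).
Qed.

Let tvE : \int[P]_w tv_dist (piP w) (piQ w) = \int[P]_w tv_fiber w.
Proof.
apply: ae_eq_integral_ge0 => //; first by move=> w; exact: tv_dist_ge0.
by apply: filterS fdens => w [_ dw]; rewrite (tv_distE dw).
Qed.

Let fiber_measurable (g : R -> R) w : measurable_fun setT g ->
  measurable_fun setT (fun x => g (r (w, x))).
Proof.
move=> mg; apply: measurableT_comp mg _.
by apply: measurableT_comp mr _; exact: measurable_pair1.
Qed.

Lemma tv_le_entropy (e : R) : (0 < e)%R ->
  \int[P]_w tv_dist (piP w) (piQ w) <=
  ((2 * e)^-1)%:E * \int[P]_w rel_entropy (piP w) (piQ w) + (2 * e)%:E.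
Proof.
move=> e0; rewrite tvE entropyE.
have e20 : (0 <= (2 * e)^-1)%R by rewrite invr_ge0 mulr_ge0// ltW.
have -> : (2 * e)%:E = \int[P]_w (cst (2 * e)%:E) w.
  by rewrite integral_cst// [X in _ * X](_ : _ = 1) ?mule1//; exact: probability_setT.
rewrite -ge0_integralZl// -ge0_integralD//; last 3 first.
- by move=> w _; rewrite mule_ge0.
- exact: measurable_funeM.
- by move=> w _; rewrite lee_fin mulr_ge0// ltW.
apply: ae_le_integral => //.
  by move=> w; rewrite adde_ge0 ?mule_ge0// lee_fin mulr_ge0// ltW.
apply: filterS fdens => w [_ dw].
have mrw := fiber_measurable w (@measurable_id _ _ _).
have mew := fiber_measurable w (@measurable_entropy_fun R).
(* The likelihood ratio has mean [1] under [piQ w], so [e * (r + 1)] has mean [2 * e]. *)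
have ->: (2 * e)%:E = \int[piQ w]_x (e * (r (w, x) + 1))%:E.
  under eq_integral do rewrite EFinM.
  rewrite ge0_integralZl//; last 3 first.
  - by apply/measurable_EFinP; exact: measurable_funD.
  - by move=> x _; rewrite lee_fin addr_ge0.
  - by rewrite lee_fin ltW.
  rewrite integralD_ge0_EFin// (density_integral1 dw) integral_cst1 -EFinD -EFinM.
  by rewrite mulrC.
rewrite /entropy_fiber -ge0_integralZl//; last 2 first.
- exact/measurable_EFinP.
- by move=> x _; rewrite lee_fin entropy_fun_ge0.
under [X in _ <= X + _]eq_integral do rewrite -EFinM.
rewrite -integralD_ge0_EFin//; last 4 first.
- by apply: measurable_funM.
- by move=> x; rewrite mulr_ge0// entropy_fun_ge0.
- by apply: measurable_funM => //; exact: measurable_funD.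
- by move=> x; rewrite mulr_ge0 ?addr_ge0// ltW.
apply: ge0_le_integral_EFin => //.
- apply: (fiber_measurable (g := fun s => `|s - 1|%R)).
  by apply: measurableT_comp => //; exact: measurable_funB.
- apply: measurable_funD; first exact: measurable_funM.
  by apply: measurable_funM => //; exact: measurable_funD.
- by move=> x; rewrite [X in (_ <= X)%R]addrC; exact: norm_subr1_le_entropy.
Qed.

Let lnp_fiber w : density_on measurable (piP w) (piQ w) (fun x => r (w, x)) ->
  \int[piP w]_x (lnp (r (w, x)))%:E = \int[piQ w]_x (r (w, x) * lnp (r (w, x)))%:E.
Proof.
move=> dw; rewrite (density_integralT dw).
- by apply: eq_integral => x _; rewrite muleC.
- by apply/measurable_EFinP; exact: fiber_measurable (@measurable_lnp R).
- by move=> x; rewrite lee_fin lnp_ge0.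
Qed.

(** Finite entropy thus makes the positive part of the log-likelihood ratio integrable. The added
    [1] is the mean of the ratio itself in [r * lnp r <= entropy_fun r + r]. *)
Lemma integral_lnp_le_entropy : \int[P]_w (lnp (r (graph_stat C xi w)))%:E <=
  \int[P]_w rel_entropy (piP w) (piQ w) + 1.
Proof.
have lnp0 z : 0 <= (lnp (r z))%:E by rewrite lee_fin lnp_ge0.
have mlnp := measurable_fiber (@measurable_lnp R).
rewrite (disintegration Cm mxi HP mlnp lnp0) integral_subfield; last 2 first.
- exact: (measurable_integral_conditional HP mlnp lnp0).
- by move=> w; apply: integral_ge0.
rewrite entropyE -(integral_cst1 P) -ge0_integralD//.
apply: ae_le_integral => //.
- by move=> w; apply: integral_ge0.
- by move=> w; rewrite adde_ge0.
apply: filterS fdens => w [_ dw]; rewrite lnp_fiber//.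
have mrw := fiber_measurable w (@measurable_id _ _ _).
have mew := fiber_measurable w (@measurable_entropy_fun R).
have mlw := fiber_measurable w (@measurable_lnp R).
have e0 x : (0 <= entropy_fun (r (w, x)))%R by exact: entropy_fun_ge0.
rewrite -(density_integral1 dw) /entropy_fiber -integralD_ge0_EFin//.
apply: ge0_le_integral_EFin.
- exact: measurable_funM.
- by move=> x; rewrite mulr_ge0// lnp_ge0.
- exact: measurable_funD.
- by move=> x; exact: lnp_le_entropy_fun.
by move=> x; exact: (r0 (w, x)).
Qed.

Lemma entropy_le_tv (K : R) : (0 <= K)%R ->
  \int[P]_w rel_entropy (piP w) (piQ w) <=
  K%:E * \int[P]_w tv_dist (piP w) (piQ w) +
  \int[P]_w (lnp_tail K (r (graph_stat C xi w)))%:E.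
Proof.
move=> K0.
have tail_ge0 z : (0 <= lnp_tail K (r z))%R.
  by rewrite /lnp_tail; case: ifP => // _; exact: lnp_ge0.
have tail0 z : 0 <= (lnp_tail K (r z))%:E by rewrite lee_fin.
have mtail := measurable_fiber (measurable_lnp_tail K).
have mtailP := measurable_integral_conditional HP mtail tail0.
have tailP0 w : 0 <= \int[piP w]_x (lnp_tail K (r (w, x)))%:E by exact: integral_ge0.
rewrite (disintegration Cm mxi HP mtail tail0) integral_subfield// entropyE tvE.
have mtailO : measurable_fun setT (fun w : O => \int[piP w]_x (lnp_tail K (r (w, x)))%:E).
  exact: from_OC mtailP.
rewrite -ge0_integralZl// -ge0_integralD//; last 2 first.
- by move=> w _; rewrite mule_ge0.
- exact: measurable_funeM.
apply: ae_le_integral => //.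
  by move=> w; rewrite adde_ge0 ?mule_ge0.
apply: filterS fdens => w [_ dw].
have mrw := fiber_measurable w (@measurable_id _ _ _).
have mew := fiber_measurable w (@measurable_entropy_fun R).
have mlw := fiber_measurable w (@measurable_lnp R).
have mtw := fiber_measurable w (measurable_lnp_tail K).
have maw : measurable_fun setT (fun x => `|r (w, x) - 1|%R).
  apply: (fiber_measurable (g := fun s => `|s - 1|%R)).
  by apply: measurableT_comp => //; exact: measurable_funB.
(* In [entropy_fun r + r <= r * lnp r + 1] the extra terms [r] and [1] have the same [piQ w]-mean,
   so they cancel after integration. *)
have I1 : entropy_fiber w <= \int[piQ w]_x (r (w, x) * lnp (r (w, x)))%:E.
  rewrite -(@leeD2rE _ 1)// -{1}(density_integral1 dw) -(integral_cst1 (piQ w)).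
  have e0 x : (0 <= entropy_fun (r (w, x)))%R by exact: entropy_fun_ge0.
  have p0 x : (0 <= r (w, x) * lnp (r (w, x)))%R by rewrite mulr_ge0// lnp_ge0.
  have mp : measurable_fun setT (fun x => r (w, x) * lnp (r (w, x)))%R by exact: measurable_funM.
  rewrite /entropy_fiber -!integralD_ge0_EFin//.
  apply: ge0_le_integral_EFin.
  - exact: measurable_funD.
  - by move=> x; exact: addr_ge0 (e0 x) (r0 _).
  - exact: measurable_funD.
  - by move=> x; exact: entropy_fun_le_lnp.
  by move=> x; exact: (r0 (w, x)).
apply: le_trans I1 _.
rewrite (density_integralT dw)//; last exact/measurable_EFinP.
rewrite /tv_fiber -ge0_integralZl//; last exact/measurable_EFinP.
under [X in _ <= X + _]eq_integral do rewrite -EFinM.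
under [X in _ <= _ + X]eq_integral do rewrite -EFinM.
rewrite -integralD_ge0_EFin//; last 4 first.
- exact: measurable_funM.
- by move=> x; rewrite mulr_ge0.
- exact: measurable_funM.
- by move=> x; exact: mulr_ge0 (tail_ge0 (w, x)) (r0 (w, x)).
apply: ge0_le_integral_EFin.
- exact: measurable_funM.
- by move=> x; rewrite mulr_ge0// lnp_ge0.
- by apply: measurable_funD; exact: measurable_funM.
(* Above [K] the tail term alone suffices; up to [K] the factor [r] is at most [K] and the logarithm
   at most [|r - 1|]. *)
- move=> x; rewrite /lnp_tail; case: ltP => rK.
    have := mulr_ge0 K0 (normr_ge0 (r (w, x) - 1)%R).
    by rewrite -/(r (w, x)) [X in (_ <= _ + X)%R]mulrC lerDr.
  by rewrite mul0r addr0; exact: mulr_lnp_truncated (r0 _) rK.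
Qed.

End one_time.

(** * Tails of log-likelihood ratios *)

Section tails.
Context {dO} {O : measurableType dO} {R : realType} (P Q : probability O R).
Implicit Types M l : O -> R.

Lemma density_ae_gt0 M : (forall w, 0 <= M w)%R -> measurable [set w | M w = 0%R] ->
  P [set w | M w = 0%R] = \int[Q]_(w in [set w | M w = 0%R]) (M w)%:E ->
  {ae P, forall w, (0 < M w)%R}.
Proof.
move=> M0 mN PN; exists [set w | M w = 0%R]; split => //.
- by rewrite PN integral0_eq// => w /= ->.
- by move=> w /= /negP; rewrite lt0r M0 andbT negbK => /eqP.
Qed.

Let mtail (f : O -> R) (c : R) : measurable_fun setT f ->
  measurable_fun setT (fun w => Num.max (ln (f w) - c)%R 0%R).
Proof.
move=> mf; apply: measurable_maxr => //; apply: measurable_funB => //.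
exact: measurableT_comp (@measurable_ln R) mf.
Qed.

Let tail_ge0 (f : O -> R) (c : R) w : (0 <= Num.max (ln (f w) - c) 0)%R.
Proof. by rewrite le_max lexx orbT. Qed.

(* Data processing for the tails of a log-likelihood ratio: [M1 / M0] has
   [P]-mean at most [1] on the event, and [ln x <= x - 1]. *)
Lemma integral_tail_le (G : set (set O)) (M0 M1 l : O -> R) (c : R) :
  sigma_algebra setT G -> G `<=` measurable ->
  density_on G P Q M0 -> measurable_wrt G M1 -> measurable_wrt G l ->
  (forall w, 0 <= M1 w)%R -> (forall w, 0 <= l w)%R ->
  {ae P, forall w, (0 < M0 w)%R} -> {ae P, forall w, (0 < M1 w)%R} ->
  {ae P, forall w, (0 < l w)%R} ->
  (let A := [set w | expR c < M1 w / l w]%R in P A = \int[Q]_(w in A) (M1 w)%:E) ->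
  \int[P]_w (Num.max (ln (M1 w / l w) - c) 0)%:E <=
  \int[P]_w (Num.max (ln (M0 w / l w) - c) 0)%:E.
Proof.
move=> sG Gm dM0 GM1 Gl M10 l0 aeM0 aeM1 ael; set A := (X in let A := X in _) => /= PA.
have [GM0 M00 _] := dM0.
have mM0 : measurable_fun setT M0 by exact: measurable_wrt_measurable GM0.
have mM1 : measurable_fun setT M1 by exact: measurable_wrt_measurable GM1.
have ml : measurable_fun setT l by exact: measurable_wrt_measurable Gl.
have mr : measurable_fun setT (fun w => M1 w / l w)%R by exact: measurable_fun_div_ge0.
have Gq (f g : O -> R) : measurable_wrt G f -> measurable_wrt G g -> (forall w, 0 <= g w)%R ->
    measurable_wrt G (fun w => f w / g w)%R.
  move=> /(measurable_wrtP _ sG) Gf /(measurable_wrtP _ sG) Gg g0.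
  by apply/(measurable_wrtP _ sG); exact: measurable_fun_div_ge0.
have GA : G A.
  have := Gq _ _ GM1 Gl l0 `]expR c, +oo[%classic (measurable_itv _).
  by congr G; apply/seteqP; split => w /=; rewrite in_itv/= andbT.
have mA := Gm _ GA.
have mquot : measurable_fun setT (fun w => M1 w / M0 w)%R by exact: measurable_fun_div_ge0.
have quot0 w : (0 <= M1 w / M0 w)%R by rewrite divr_ge0.
have mindic : measurable_fun setT (\1_A : O -> R) by exact: measurable_indic.
have PAE : \int[P]_w (\1_A w)%:E = P A by rewrite integral_indic// setIT.
have PAfin : P A \is a fin_num by rewrite fin_num_measure.
(* On [A], [ln (M1 / l)] is [ln (M0 / l) + ln (M1 / M0)], and the last logarithm plus [1] is at most
   [M1 / M0]. Carrying the [1] to the left produces [P A] and avoids a negative integrand. *)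
have key : \int[P]_w (Num.max (ln (M1 w / l w) - c) 0)%:E + P A <=
    \int[P]_w (Num.max (ln (M0 w / l w) - c) 0)%:E + \int[P]_w (\1_A w * (M1 w / M0 w))%:E.
  have mt1 := mtail c mr.
  have mt0 := mtail c (measurable_fun_div_ge0 mM0 ml l0).
  have t1 := tail_ge0 (fun w => M1 w / l w)%R c.
  have t0 := tail_ge0 (fun w => M0 w / l w)%R c.
  rewrite -PAE -integralD_ge0_EFin// -integralD_ge0_EFin//; last 2 first.
  - exact: measurable_funM.
  - by move=> w; rewrite mulr_ge0.
  apply: ae_le_integral.
  - by move=> w; rewrite lee_fin addr_ge0.
  - by move=> w; rewrite lee_fin addr_ge0// mulr_ge0.
  apply: filterS3 aeM0 aeM1 ael => w M0w M1w lw; rewrite lee_fin indicE.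
  have [wA|wA] := boolP (w \in A); last first.
    rewrite addr0 mul0r addr0 max_r//.
    have : (M1 w / l w <= expR c)%R.
      by rewrite leNgt; apply/negP => h; move: wA; rewrite notin_setE; exact.
    by rewrite subr_le0 -ler_ln ?posrE ?expR_gt0 ?divr_gt0// expRK.
  have : (expR c < M1 w / l w)%R by move/set_mem: wA.
  rewrite -ltr_ln ?posrE ?expR_gt0 ?divr_gt0// expRK => lnc.
  rewrite mul1r max_l; last by rewrite subr_ge0 ltW.
  have h : (ln (M0 w / l w) - c <= Num.max (ln (M0 w / l w) - c) 0)%R by rewrite le_max lexx.
  have := @ln_le_subr1 R _ (divr_gt0 M1w M0w).
  move: h lnc; rewrite !ln_div ?posrE// /=; lra.
(* Under [Q] the factor [M0] cancels the denominator, or gives zero where [M0] vanishes. What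
   remains is the [Q]-integral of [M1] over [A], so [M1] has to act as a density on this one event
   only. *)
have last_le : \int[P]_w (\1_A w * (M1 w / M0 w))%:E <= P A.
  rewrite (density_integral sG Gm dM0); last 2 first.
  - apply/(measurable_wrtP _ sG)/measurable_EFinP/measurable_funM.
      by apply: measurable_indic; rewrite measurable_g_measurableTypeE.
    by apply/(measurable_wrtP _ sG); exact: Gq.
  - by move=> w; rewrite lee_fin mulr_ge0.
  rewrite PA [leRHS]integral_indic_weight//.
  under [leLHS]eq_integral do rewrite -EFinM.
  under [leRHS]eq_integral do rewrite -EFinM.
  apply: ge0_le_integral_EFin.
  - by apply: measurable_funM => //; exact: measurable_funM.
  - by move=> w; rewrite mulr_ge0// mulr_ge0.
  - exact: measurable_funM.
  - move=> w; rewrite -mulrA ler_wpM2l//.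
    have [->|M0w] := eqVneq (M0 w) 0%R; first by rewrite mulr0.
    by rewrite divfK.
by rewrite -(@leeD2rE _ (P A))//; apply: le_trans key _; rewrite leeD2l.
Qed.

Lemma integral_inv_tail_le (G : set (set O)) (l l1 : O -> R) (c : R) :
  sigma_algebra setT G -> G `<=` measurable ->
  density_on G P Q l1 -> measurable_wrt G l -> (forall w, 0 <= l w)%R ->
  {ae P, forall w, (0 < l1 w)%R} -> {ae P, forall w, (0 < l w)%R} ->
  \int[Q]_w (l w)%:E <= 1 ->
  \int[P]_w (Num.max (ln (l1 w / l w)^-1 - c) 0)%:E <= (expR (- c))%:E.
Proof.
move=> sG Gm dl1 Gl l0 ael1 ael Ql.
have [Gl1 l10 _] := dl1.
have ml : measurable_fun setT l by exact: measurable_wrt_measurable Gl.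
have ml1 : measurable_fun setT l1 by exact: measurable_wrt_measurable Gl1.
have mquot : measurable_fun setT (fun w => l w / l1 w)%R by exact: measurable_fun_div_ge0.
have Gquot : measurable_wrt G (fun w => l w / l1 w)%R.
  move: Gl Gl1 => /(measurable_wrtP _ sG) Gl /(measurable_wrtP _ sG) Gl1.
  by apply/(measurable_wrtP _ sG); exact: measurable_fun_div_ge0.
apply: (@le_trans _ _ (\int[P]_w (expR (- c) * (l w / l1 w))%:E)).
  apply: ae_le_integral.
  - by move=> w; rewrite lee_fin le_max lexx orbT.
  - by move=> w; rewrite lee_fin mulr_ge0 ?expR_ge0// divr_ge0.
  apply: filterS2 ael1 ael => w l1w lw; rewrite lee_fin invf_div.
  by apply: ln_tail_le; rewrite divr_gt0.
under eq_integral do rewrite EFinM.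
rewrite ge0_integralZl//; last 2 first.
- exact/measurable_EFinP.
- by move=> w _; rewrite lee_fin divr_ge0.
rewrite -[leRHS]mule1; apply: lee_wpmul2l; first by rewrite lee_fin expR_ge0.
apply: le_trans Ql.
rewrite (density_integral sG Gm dl1); last 2 first.
- by apply: (measurable_wrt_comp (S := R)) Gquot; exact/measurable_EFinP.
- by move=> w; rewrite lee_fin divr_ge0.
under eq_integral do rewrite -EFinM.
apply: ge0_le_integral_EFin => //.
- exact: measurable_funM.
- by move=> w; rewrite mulr_ge0// divr_ge0.
- move=> w; have [->|l1w] := eqVneq (l1 w) 0%R; first by rewrite mulr0.
  by rewrite divfK.
Qed.

Lemma integral_lnp_tail_le (M l l1 : O -> R) (c : R) : (0 < c)%R ->
  measurable_fun setT M -> measurable_fun setT l -> measurable_fun setT l1 ->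
  (forall w, 0 <= l w)%R -> (forall w, 0 <= l1 w)%R ->
  {ae P, forall w, (0 < M w)%R} -> {ae P, forall w, (0 < l w)%R} ->
  {ae P, forall w, (0 < l1 w)%R} ->
  \int[P]_w (lnp_tail (expR (4 * c)) (M w / l1 w))%:E <=
  2%:E * (\int[P]_w (Num.max (ln (M w / l w) - c) 0)%:E +
          \int[P]_w (Num.max (ln (l1 w / l w)^-1 - c) 0)%:E).
Proof.
move=> c0 mM ml ml1 l0 l10 aeM ael ael1.
have m1 : measurable_fun setT (fun w => Num.max (ln (M w / l w) - c) 0)%R.
  by apply: (mtail (f := fun w => M w / l w)%R); exact: measurable_fun_div_ge0.
have m2 : measurable_fun setT (fun w => Num.max (ln (l1 w / l w)^-1 - c) 0)%R.
  rewrite (_ : (fun w => _) = (fun w => Num.max (ln (l w / l1 w) - c) 0)%R); last first.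
    by apply/funext => w; rewrite invf_div.
  by apply: (mtail (f := fun w => l w / l1 w)%R); exact: measurable_fun_div_ge0.
have p1 w : (0 <= Num.max (ln (M w / l w) - c) 0)%R by rewrite le_max lexx orbT.
have p2 w : (0 <= Num.max (ln (l1 w / l w)^-1 - c) 0)%R by rewrite le_max lexx orbT.
rewrite -integralD_ge0_EFin// -ge0_integralZl//; last 2 first.
- by apply/measurable_EFinP; exact: measurable_funD.
- by move=> w _; rewrite lee_fin addr_ge0.
apply: ae_le_integral.
- by move=> w; rewrite lee_fin /lnp_tail; case: ifP => // _; exact: lnp_ge0.
- by move=> w; rewrite mule_ge0// lee_fin addr_ge0.
apply: filterS3 aeM ael ael1 => w Mw lw l1w; rewrite -EFinM lee_fin /lnp_tail.
case: ltP => [h|_]; last by rewrite mulr_ge0// addr_ge0.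
have E : (M w / l1 w = (M w / l w) / (l1 w / l w))%R.
  by field; rewrite !gt_eqF.
(* The threshold [expR (4 * c)] is at least [1], so on the tail [lnp] is [ln]. *)
have K1 : (1 <= M w / l1 w)%R.
  by apply: le_trans (ltW h); rewrite -expR0 ler_expR mulr_ge0// ltW.
rewrite /lnp max_l; last exact: ln_ge0.
by rewrite E; apply: ln_tail_split; rewrite ?divr_gt0// -E.
Qed.

End tails.

Lemma graph_stat_wrt {dO dX} {O : measurableType dO} {X : measurableType dX}
    (C : set (set O)) (xi : O -> X) (G : set (set O)) (A : set (g_sigma_algebraType C * X)) :
  sigma_algebra setT G -> <<s C >> `<=` G -> measurable_wrt G xi ->
  measurable A -> G (graph_stat C xi @^-1` A).
Proof.
move=> sG CG /(measurable_wrtP _ sG) mxi mA.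
have mid : measurable_fun setT (id : g_sigma_algebraType G -> g_sigma_algebraType C).
  by move=> _ B mB; rewrite setTI measurable_g_measurableTypeE//; exact: CG.
have := measurable_fun_pair mid mxi measurableT mA.
by rewrite setTI measurable_g_measurableTypeE.
Qed.

(** * Stability of the filter *)

Section filter_stability.
Context {R : realType} {dX dY dZ dO : measure_display}
  {X : measurableType dX} {Y : measurableType dY} {Z : measurableType dZ}
  {O : measurableType dO}
  (T : R.-pker X ~> X) (q : probability Z R) (h : X -> Z -> Y)
  (Xs : nat -> O -> X) (Zs : nat -> O -> Z)
  (P Q : probability O R) (mu nu : probability X R)
  (piP piQ : nat -> O -> probability X R).
Hypotheses (bX : standard_borel R X)
  (mh : measurable_fun setT (fun p : X * Z => h p.1 p.2))
  (mX : forall n, measurable_fun setT (Xs n))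
  (mZ : forall n, measurable_fun setT (Zs n))
  (lawP : hmm_law T q Xs Zs P mu) (lawQ : hmm_law T q Xs Zs Q nu)
  (HP : forall n, is_filter P Xs (obs h Xs Zs) n (piP n))
  (HQ : forall n, is_filter Q Xs (obs h Xs Zs) n (piQ n))
  (munu : mu `<< nu).
Local Notation Ys := (obs h Xs Zs).

Let obs_wrt G n : sigma_algebra setT G -> measurable_wrt G (Xs n) ->
  measurable_wrt G (Zs n) -> measurable_wrt G (Ys n).
Proof.
move=> sG /(measurable_wrtP _ sG) GX /(measurable_wrtP _ sG) GZ.
apply/(measurable_wrtP _ sG).
exact: (measurableT_comp mh (measurable_fun_pair GX GZ)).
Qed.

Let mY n : measurable_fun setT (Ys n).
Proof. exact: (measurableT_comp mh (measurable_fun_pair (mX n) (mZ n))). Qed.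

(** The generators of [sigma_upto Ys n], named so that the observation field can serve as a
    measurable space of its own. *)
Let gen n : set (set O) :=
  \bigcup_(i in `I_n.+1) preimage_set_system setT (Ys i) measurable.

Let gen_measurable n : <<s gen n >> `<=` measurable.
Proof. exact: (sigma_upto_measurable (n := n) mY). Qed.

Let gen_le n k : (n <= k)%N -> <<s gen n >> `<=` <<s gen k >>.
Proof. exact: sigma_upto_le. Qed.

Let sgen n : sigma_algebra setT <<s gen n >>.
Proof. exact: smallest_sigma_algebra. Qed.

Let HPc n : conditional_law (gen n) (Xs n) P (piP n). Proof. exact: HP. Qed.
Let HQc n : conditional_law (gen n) (Xs n) Q (piQ n). Proof. exact: HQ. Qed.

Local Notation graph n := (graph_stat (gen n) (Xs n)).

(** [m] is [M_n] as a function of the observation history and the current state, and [l] is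
    [L_n]. *)
Definition filter_densities n (m : g_sigma_algebraType (gen n) * X -> R) (l : O -> R) :=
  [/\ measurable_fun setT m, forall z, (0 <= m z)%R,
      forall A, measurable A -> P (graph n @^-1` A) =
        \int[Q]_(w in graph n @^-1` A) (m (graph n w))%:E
    & density_on <<s gen n >> P Q l].

Arguments filter_densities : clear implicits.

(** Started at time [0], the propagated field contains all states and noises up to [n], and [P] has
    a density on it; absolute continuity passes to the fields inside. *)
Let absolutely_continuous n : exists G, [/\ sigma_algebra setT G, <<s gen n >> `<=` G,
  measurable_wrt G (Xs n) & forall A, G A -> Q A = 0 -> P A = 0].
Proof.
have [G [m [[sG GJ GXn [Gmm m0 mE]] GX GZ]]] := markov_field_full mX mZ lawP lawQ n munu.
have Gm : G `<=` measurable.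
  by apply: subset_trans GJ _; exact: joint_history_measurable.
exists G; split => //.
- apply: (sigma_upto_sub (F := Ys) (n := n) sG) => i ilen.
  by apply: obs_wrt => //; [exact: GX|exact: GZ].
- move=> A GA QA; rewrite mE//; apply: null_set_integral => //; first exact: Gm.
  apply/measurable_EFinP; apply: measurable_funTS.
  exact: measurable_wrt_measurable Gmm.
Qed.

Let filter_densities_exist n : exists m l, filter_densities n m l.
Proof.
have [G [sG CG GX PQ]] := absolutely_continuous n.
have [m [mm m0 mE]] := statistic_density
  (measurable_graph_stat (@gen_measurable n) (mX n))
  (fun A mA => PQ _ (graph_stat_wrt sG CG GX mA)).
have [l [ml l0 lE]] := statistic_density (measurable_id_sub (@gen_measurable n))
  (fun A mA => PQ _ (CG _ mA)).
exists m, l; split => //; split => //.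
by move=> B mB; have := ml measurableT B mB; rewrite setTI.
Qed.

Let tv_cvg :
  ((fun n => \int[P]_w rel_entropy (piP n w) (piQ n w)) @ \oo --> 0) ->
  ((fun n => \int[P]_w tv_dist (piP n w) (piQ n w)) @ \oo --> 0).
Proof.
apply: (@cvge0_dominated _ _ _ 0%N).
- by move=> n; apply: integral_ge0 => w _; exact: tv_dist_ge0.
- by move=> n; apply: integral_ge0 => w _; exact: rel_entropy_ge0.
(* [tv_le_entropy] at [e / 2] leaves the error [2 * (e / 2) = e]. *)
move=> e e0; exists (2 * (e / 2))^-1%R.
  by rewrite invr_ge0 mulr_ge0// divr_ge0// ltW.
move=> n _; have [m [l [mm m0 mE lE]]] := filter_densities_exist n.
have := tv_le_entropy (@gen_measurable n) (mX n) bX (HPc n) (HQc n) mm m0 mE lE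
  (divr_gt0 e0 (ltr0Sn R 1)).
by rewrite [X in _ + X%:E](_ : _ = e)//; field.
Qed.

Let tail_estimate n0 n m0 l0 m l (c : R) : (n0 <= n)%N -> (0 < c)%R ->
  filter_densities n0 m0 l0 -> filter_densities n m l ->
  \int[P]_w (lnp_tail (expR (4 * c)) (m (graph n w) / l w))%:E <=
  2%:E * (\int[P]_w (Num.max (ln (m0 (graph n0 w) / l0 w) - c) 0)%:E + (expR (- c))%:E).
Proof.
move=> n0n c0 [mm0 m00 m0E l0E] [mm mge0 mE lE].
have [l0wrt l0ge0 l0P] := l0E; have [lwrt lge0 lP] := lE.
(* The field of the observations up to [n0] and the state at [n0]: small enough for [m0] to be its
   density, and it knows the state needed to propagate it. *)
pose G0 := preimage_set_system setT (graph n0) measurable.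
have mgraph k : measurable_fun setT (graph k).
  exact: measurable_graph_stat (@gen_measurable k) (mX k).
have G0E A : measurable A -> G0 (graph n0 @^-1` A) by exists A; rewrite ?setTI.
have sJ : sigma_algebra setT (joint_history Xs Zs n0) by exact: smallest_sigma_algebra.
have genJ : <<s gen n0 >> `<=` joint_history Xs Zs n0.
  apply: (sigma_upto_sub (F := Ys) (n := n0) sJ) => i ilen.
  by apply: obs_wrt => //; [exact: measurable_wrt_joint_X|exact: measurable_wrt_joint_Z].
have mf0 : markov_field Xs Zs P Q n0 G0 (m0 \o graph n0).
  split.
  - exact: sigma_algebra_preimage (sigma_algebra_measurable _).
  - move=> _ [A mA <-]; rewrite setTI; apply: graph_stat_wrt => //.
    exact: measurable_wrt_joint_X.
  - move=> B mB; apply: (G0E (snd @^-1` B)).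
    by rewrite -[X in measurable X]setTI; exact: measurable_snd.
  - split; last 2 first.
    + by move=> w; exact: m00.
    + by move=> _ [A mA <-]; rewrite setTI; exact: m0E.
    move=> B mB; apply: (G0E (m0 @^-1` B)).
    by rewrite -[X in measurable X]setTI; exact: mm0.
(* [G] contains the observations up to [n] and the state at [n], yet the density on it is still the
   one of time [n0]; hence [m] is compared with [m0] on a common field. *)
have [G [[sG GJ GXn dG] G0G GX GZ]] := markov_field_iter mX mZ lawP lawQ (n - n0) mf0.
rewrite subnKC// in GJ GXn GX GZ.
have Gm : G `<=` measurable.
  by apply: subset_trans GJ _; exact: joint_history_measurable.
have gen0G : <<s gen n0 >> `<=` G.
  move=> A genA; apply: G0G; apply: (G0E (fst @^-1` (A : set (g_sigma_algebraType (gen n0))))).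
  by rewrite -[X in measurable X]setTI; exact: measurable_fst.
have genG : <<s gen n >> `<=` G.
  apply: (sigma_upto_sub (F := Ys) (n := n) sG) => i ilen.
  have [ilen0|n0i] := leqP i n0.
    by apply: measurable_wrt_sub gen0G _; exact: (measurable_wrt_sigma_upto (F := Ys)).
  by apply: obs_wrt => //; [apply: GX|apply: GZ]; rewrite n0i.
have GM1 : measurable_wrt G (m \o graph n).
  move=> B mB; apply: (graph_stat_wrt (A := m @^-1` B)) => //.
  by rewrite -[X in measurable X]setTI; exact: mm.
have l0G : measurable_wrt G l0 by exact: measurable_wrt_sub gen0G l0wrt.
have mM k (f : g_sigma_algebraType (gen k) * X -> R) : measurable_fun setT f ->
    measurable_fun setT (f \o graph k) by move=> mf; exact: measurableT_comp mf (mgraph k).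
have ml0 : measurable_fun setT l0 by exact: measurable_wrt_measurable (@gen_measurable n0) l0wrt.
have ml : measurable_fun setT l by exact: measurable_wrt_measurable (@gen_measurable n) lwrt.
have posM k (f : g_sigma_algebraType (gen k) * X -> R) : measurable_fun setT f ->
    (forall z, 0 <= f z)%R ->
    (forall A, measurable A -> P (graph k @^-1` A) =
      \int[Q]_(w in graph k @^-1` A) (f (graph k w))%:E) ->
    {ae P, forall w, (0 < f (graph k w))%R}.
  move=> mf f0 fE; have mf0' : measurable (f @^-1` [set 0%R]).
    by rewrite -[X in measurable X]setTI; exact: mf.
  apply: (density_ae_gt0 (Q := Q) (M := f \o graph k)).
  - by move=> w; exact: f0.
  - exact: measurable_preimageT (mgraph k) mf0'.
  - exact: fE mf0'.
have posM0 := posM n0 m0 mm0 m00 m0E.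
have posM1 := posM n m mm mge0 mE.
have posl0 := density_pos_ae (@gen_measurable n0) l0E.
have posl := density_pos_ae (@gen_measurable n) lE.
have := integral_lnp_tail_le c0 (mM n m mm) ml0 ml l0ge0 lge0 posM1 posl0 posl.
move=> /le_trans; apply; apply: lee_wpmul2l; first by rewrite lee_fin.
apply: leeD.
  apply: (integral_tail_le sG Gm dG GM1 l0G (fun w => mge0 _) l0ge0 posM0 posM1 posl0).
  rewrite /=.
  (* The tail event depends only on the observations up to [n], which include those defining [l0],
     and on the state at [n]; [m] is a density there. *)
  pose rho (z : g_sigma_algebraType (gen n) * X) : R := (m z / l0 z.1)%R.
  have mrho : measurable_fun setT rho.
    have ml0n : measurable_fun setT (l0 : g_sigma_algebraType (gen n) -> R).
      by move=> _ B mB; rewrite setTI; apply: gen_le n0n _ _; exact: l0wrt.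
    exact: (measurable_fun_div_ge0 mm (measurableT_comp ml0n measurable_fst)
      (fun z => l0ge0 z.1)).
  have mA : measurable (rho @^-1` `]expR c, +oo[%classic).
    by rewrite -[X in measurable X]setTI; exact: mrho measurableT _ (measurable_itv _).
  have := mE _ mA.
  rewrite (_ : graph n @^-1` _ = [set w | expR c < m (graph n w) / l0 w]%R)//.
  by apply/seteqP; split => w /=; rewrite /rho /= in_itv/= andbT.
apply: (integral_inv_tail_le c (sgen n) (@gen_measurable n) lE
  (measurable_wrt_sub (gen_le n0n) l0wrt) l0ge0 posl posl0).
rewrite -(l0P setT); last exact: sigma_algebra_setT (sgen n0).
by rewrite [leLHS](_ : _ = 1)//; exact: probability_setT.
Qed.

Let entropy_cvg :
  (exists n0 : nat, \int[P]_w rel_entropy (piP n0 w) (piQ n0 w) < +oo) ->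
  ((fun n => \int[P]_w tv_dist (piP n w) (piQ n w)) @ \oo --> 0) ->
  ((fun n => \int[P]_w rel_entropy (piP n w) (piQ n w)) @ \oo --> 0).
Proof.
move=> [n0 fin]; apply: (@cvge0_dominated _ _ _ n0).
- by move=> n; apply: integral_ge0 => w _; exact: rel_entropy_ge0.
- by move=> n; apply: integral_ge0 => w _; exact: tv_dist_ge0.
move=> e e0; have [m0 [l0 D0]] := filter_densities_exist n0.
have [mm0 m00 m0E l0E] := D0; have [l0wrt l0ge0 _] := l0E.
have mrho : measurable_fun setT (fun w => m0 (graph n0 w) / l0 w)%R.
  apply: measurable_fun_div_ge0 => //.
    exact: (measurableT_comp mm0 (measurable_graph_stat (@gen_measurable n0) (mX n0))).
  exact: measurable_wrt_measurable (@gen_measurable n0) l0wrt.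
have finlnp : \int[P]_w (lnp (m0 (graph n0 w) / l0 w))%:E < +oo.
  apply: le_lt_trans (integral_lnp_le_entropy (@gen_measurable n0) (mX n0) bX
    (HPc n0) (HQc n0) mm0 m00 m0E l0E) _.
  by rewrite lte_add_pinfty// ltry.
have /fine_cvgP[tfin /cvgrPdist_le tail0] := lnp_tail_cvg0 mrho finlnp.
have e4 : (0 < e / 4)%R by rewrite divr_gt0.
(* [k] depends only on [e] and the densities at time [n0], which makes the resulting bound uniform
   in [n]. Two terms of size [e / 4], doubled by [tail_estimate], add up to [e]. *)
have [k [k0 tk ek]] : exists k : nat, [/\ (0 < k)%N,
    \int[P]_w (Num.max (ln (m0 (graph n0 w) / l0 w) - k%:R) 0)%:E <= (e / 4)%:E
    & (expR (- k%:R) <= e / 4)%R].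
  near \oo => k; exists k; split.
  - by near: k; exists 1%N.
  - have tf : \int[P]_w (Num.max (ln (m0 (graph n0 w) / l0 w) - k%:R) 0)%:E \is a fin_num.
      by near: k.
    have td : (`|0 - fine (\int[P]_w (Num.max (ln (m0 (graph n0 w) / l0 w) - k%:R) 0)%:E)|
        <= e / 4)%R by near: k; exact: tail0.
    rewrite -(fineK tf) lee_fin; move: td; rewrite sub0r normrN; apply: le_trans.
    exact: ler_norm.
  (* Since [expR k] is at least [1 + k], taking [k] above [4 / e] brings [expR (- k)] below
     [e / 4]. *)
  - have kge : (4 / e <= k%:R)%R.
      by apply: le_trans (ltW (truncnS_gt _)) _; rewrite ler_nat; near: k; exists (Num.trunc (4 / e)).+1.
    rewrite expRN -[leRHS]invrK lef_pV2 ?posrE ?expR_gt0 ?invr_gt0//.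
    rewrite invf_div; apply: le_trans kge _; apply: le_trans (expR_ge1Dx _).
    by rewrite lerDr.
exists (expR (4 * k%:R)); first exact: expR_ge0.
move=> n n0n; have [m [l D]] := filter_densities_exist n.
have [mm mge0 mE lE] := D.
apply: le_trans (entropy_le_tv (@gen_measurable n) (mX n) bX (HPc n) (HQc n) mm mge0 mE lE
  (expR_ge0 (4 * k%:R))) _.
apply: leeD => //.
have kR0 : (0 < k%:R :> R)%R by rewrite ltr0n.
apply: le_trans (tail_estimate n0n kR0 D0 D) _.
have -> : e%:E = 2%:E * ((e / 4)%:E + (e / 4)%:E).
  by rewrite -EFinD -EFinM; congr EFin; field.
by apply: lee_wpmul2l; rewrite ?lee_fin//; apply: leeD => //; rewrite lee_fin.
Unshelve. all: by end_near. Qed.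

Lemma filter_stability_iff :
  (exists n0 : nat, \int[P]_w rel_entropy (piP n0 w) (piQ n0 w) < +oo) ->
  ((fun n => \int[P]_w rel_entropy (piP n w) (piQ n w)) @ \oo --> 0)
  <-> ((fun n => \int[P]_w tv_dist (piP n w) (piQ n w)) @ \oo --> 0).
Proof. by move=> fin; split; [exact: tv_cvg|exact: entropy_cvg]. Qed.

End filter_stability.

Unset Implicit Arguments.
Set Strict Implicit.

Theorem theorem7 (R : realType) (dX dY dZ dO : measure_display)
  (X : measurableType dX) (Y : measurableType dY) (Z : measurableType dZ)
  (O : measurableType dO)
  (T : R.-pker X ~> X) (Q : probability Z R) (h : X -> Z -> Y)
  (Xs : nat -> O -> X) (Zs : nat -> O -> Z)
  (Pmu Pnu : probability O R) (mu nu : probability X R)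
  (pimu pinu : nat -> O -> probability X R) :
  standard_borel R X -> standard_borel R Y -> standard_borel R Z ->
  measurable_fun setT (fun p : X * Z => h p.1 p.2) ->
  (forall n, measurable_fun setT (Xs n)) ->
  (forall n, measurable_fun setT (Zs n)) ->
  hmm_law T Q Xs Zs Pmu mu ->
  hmm_law T Q Xs Zs Pnu nu ->
  (forall n, is_filter Pmu Xs (obs h Xs Zs) n (pimu n)) ->
  (forall n, is_filter Pnu Xs (obs h Xs Zs) n (pinu n)) ->
  mu `<< nu ->
  (exists n0 : nat, \int[Pmu]_w rel_entropy (pimu n0 w) (pinu n0 w) < +oo) ->
  (exists m : nat, rel_entropy_on (sigma_upto (obs h Xs Zs) m) Pmu Pnu < +oo) ->
  ((fun n => \int[Pmu]_w rel_entropy (pimu n w) (pinu n w)) @ \oo --> 0)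
  <-> ((fun n => \int[Pmu]_w tv_dist (pimu n w) (pinu n w)) @ \oo --> 0).
Proof.
move=> bX _ _ mh mX mZ lawP lawQ HP HQ munu fin _.
exact: filter_stability_iff bX mh mX mZ lawP lawQ HP HQ munu fin.
Qed.
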